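(* Let $V$ be a finite-dimensional real vector space and let $C\subseteq V$ be a closed, convex, pointed and generating cone. Then $D_C=(-C)\cup\{\bot\}$ is an FS-domain. Moreover, $D_C$ is an RB-domain if and only if $C$ is simplicial.
   Context: Throughout, $V$ has dimension $d\ge 1$. A subset $C\subseteq V$ is a cone if $tc\in C$ for all $c\in C$, $t\ge 0$. It is pointed if $C\cap(-C)=\{0\}$ and generating if $C-C=V$. A closed, convex, pointed, generating cone is simplicial if there is a basis $v_1,\dots,v_d$ of $V$ with $C=\{\sum_{j=1}^d t_jv_j : t_j\ge 0\}$. Cone order: $x\le_C y$ iff $y-x\in C$. The poset $D_C=(-C)\cup\{\bot\}$ consists of $-C$ with the order $\le_C$, together with a new element $\bot$ declared to be the least element. A subset of a poset is directed if it is nonempty and any two of its elements have an upper bound in it. A dcpo is a poset in which every directed subset has a supremum. A map between dcpos is Scott-continuous if it is monotone and preserves directed suprema. In a dcpo $D$, $x\ll y$ means: whenever $A\subseteq D$ is directed and $y\le\sup A$, some $a\in A$ satisfies $x\le a$. A dcpo $D$ is continuous if for every $y\in D$ the set $\{x: x\ll y\}$ is directed with supremum $y$. A domain is a continuous dcpo. A Scott-continuous map $f:D\to D$ is finitely separated from the identity if there is a finite set $M\subseteq D$ such that for every $x\in D$ there is $m\in M$ with $f(x)\le m\le x$. A domain $D$ is an FS-domain if $\mathrm{id}_D$ is the pointwise supremum of a directed family (for the pointwise order) of Scott-continuous self-maps finitely separated from the identity. A deflation on a dcpo $D$ is a Scott-continuous map $r:D\to D$ with finite image and $r\le \mathrm{id}_D$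 pointwise. An RB-domain is a Scott-continuous retract of a bifinite domain (a dcpo whose identity is the pointwise supremum of a directed family of idempotent deflations). By a known theorem of Jung, a dcpo is an RB-domain if and only if it admits a directed family (for the pointwise order) of deflations whose pointwise supremum is the identity map. *)

(* Defs.v *)
From HB Require Import structures.
From mathcomp Require Import all_boot all_order all_algebra.
From mathcomp Require Import boolp classical_sets functions cardinality.
From mathcomp Require Import reals interval_inference.
From mathcomp Require Import convex topology normedtype.

Set Implicit Arguments.
Unset Strict Implicit.
Unset Printing Implicit Defensive.

Import Order.TTheory GRing.Theory Num.Theory.
Import numFieldNormedType.Exports.

Local Open Scope classical_set_scope.
Local Open Scope ring_scope.
Local Open Scope convex_scope.

Section DomainTheory.
Local Open Scope order_scope.

Definition directed d (D : porderType d) (A : set D) : Prop :=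
  A !=set0 /\
  forall x y, A x -> A y -> exists z, [/\ A z, x <= z & y <= z].

Definition is_dcpo d (D : porderType d) : Prop :=
  forall A : set D, directed A -> exists s, isLub A s.

Definition scott_continuous d d' (D : porderType d) (E : porderType d')
    (f : D -> E) : Prop :=
  {homo f : x y / x <= y} /\
  forall (A : set D) (s : D),
    directed A -> isLub A s -> isLub (f @` A) (f s).

Definition way_below d (D : porderType d) (x y : D) : Prop :=
  forall (A : set D) (s : D),
    directed A -> isLub A s -> y <= s -> exists2 a, A a & x <= a.

Definition is_domain d (D : porderType d) : Prop :=
  is_dcpo D /\
  forall y : D, let B := [set x | way_below x y] in directed B /\ isLub B y.

(* [directed F] refers to the pointwise order on [D -> D] from boolp. *)
Definition directed_approx_id d (D : porderType d) (F : set (D -> D)) : Prop :=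
  directed F /\ forall x, isLub [set f x | f in F] x.

Definition finitely_separated d (D : porderType d) (f : D -> D) : Prop :=
  exists2 M : set D, finite_set M &
    forall x, exists m, [/\ M m, f x <= m & m <= x].

Definition FS_domain d (D : porderType d) : Prop :=
  is_domain D /\
  exists2 F : set (D -> D), directed_approx_id F &
    forall f, F f -> scott_continuous f /\ finitely_separated f.

Definition deflation d (D : porderType d) (r : D -> D) : Prop :=
  [/\ scott_continuous r, finite_set (range r) & forall x, r x <= x].

Definition bifinite_domain d (D : porderType d) : Prop :=
  is_dcpo D /\
  exists2 F : set (D -> D), directed_approx_id F &
    forall f, F f -> deflation f /\ idempotent_fun f.

Definition scott_retract d d' (D : porderType d) (E : porderType d') : Prop :=
  exists (s : D -> E) (r : E -> D),
    [/\ scott_continuous s, scott_continuous r & cancel s r].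

Definition RB_domain d (D : porderType d) : Prop :=
  is_dcpo D /\
  exists (d' : Order.disp_t) (E : porderType d'),
    bifinite_domain E /\ scott_retract D E.

End DomainTheory.

Section Cones.
Variables (R : realType) (V : vectType R).
Implicit Types C : set V.

Definition is_cone C : Prop :=
  forall (c : V) (t : R), C c -> 0 <= t -> C (t *: c).

Definition pointed_cone C : Prop := C `&` [set - c | c in C] = [set 0].

Definition generating_cone C : Prop :=
  [set x - y | x in C & y in C] = [set: V].

(* [V] carries no topology of its own: closedness is with respect to the
   canonical one, i.e. that of the coordinate space 'rV[R]_d, which does not
   depend on the choice of the basis. *)
Definition vect_closed C : Prop :=
  closed [set passmx.rVof (vbasis {:V}) c | c in C].

Record ccpg_cone C : Prop := CCPGCone {
  ccpg_cone_cone : is_cone C;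
  ccpg_cone_closed : vect_closed C;
  ccpg_cone_convex : convex_set (C : set (convex_lmodType V));
  ccpg_cone_pointed : pointed_cone C;
  ccpg_cone_generating : generating_cone C }.

Definition simplicial C : Prop :=
  exists v : (\dim {:V}).-tuple V,
    basis_of {:V} v /\
    C = [set x | exists2 t : 'I_(\dim {:V}) -> R,
                   (forall j, 0 <= t j) & x = \sum_j t j *: v`_j].

End Cones.

Section ConeDomain.
Variables (R : realType) (V : vectType R) (C : set V) (hC : ccpg_cone C).

Definition cone_le (x y : V) : Prop := C (y - x).

Lemma cone_le_refl x : cone_le x x.
Proof.
have [C0 _] : (C `&` [set - c | c in C]) 0 by rewrite (ccpg_cone_pointed hC).
by rewrite /cone_le subrr.
Qed.

Lemma cone_le_anti x y : cone_le x y -> cone_le y x -> x = y.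
Proof.
move=> xy yx; apply/esym/eqP; rewrite -subr_eq0; apply/eqP.
suff : (C `&` [set - c | c in C]) (y - x) by rewrite (ccpg_cone_pointed hC).
by split => //; exists (x - y) => //; rewrite opprB.
Qed.

Lemma cone_le_trans x y z : cone_le x y -> cone_le y z -> cone_le x z.
Proof.
move=> xy yz.
have h0 : 0 <= (2^-1 : R) by rewrite invr_ge0 ler0n.
have h1 : (2^-1 : R) <= 1 by rewrite invf_le1 ?ler1n ?ltr0n.
have := ccpg_cone_convex hC (Itv01 h0 h1) (mem_set xy) (mem_set yz).
move/set_mem => /(ccpg_cone_cone hC)/(_ (ler0n R 2)).
have -> : (y - x : convex_lmodType V) <| Itv01 h0 h1 |> (z - y) =
          2^-1 *: (y - x) + (1 - 2^-1) *: (z - y) :> V by [].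
have -> : 1 - 2^-1 = 2^-1 :> R by rewrite {1}(splitr 1) div1r addrK.
rewrite -scalerDr scalerA mulfV ?pnatr_eq0// scale1r.
by rewrite addrC addrA subrK.
Qed.

(* [hC] is a phantom parameter: it makes the order instance below available.
   [None] stands for the bottom element. *)
Definition cone_domain of ccpg_cone C : Type :=
  option (set_type [set - c | c in C]).

Local Notation D := (cone_domain hC).

HB.instance Definition _ := Choice.on D.

Definition cone_domain_le (x y : D) : bool :=
  match x, y with
  | None, _ => true
  | Some _, None => false
  | Some a, Some b => `[< cone_le (val a) (val b) >]
  end.

Lemma cone_domain_le_refl : reflexive cone_domain_le.
Proof. by case=> [a|] //=; apply/asboolP; exact: cone_le_refl. Qed.

Lemma cone_domain_le_anti : antisymmetric cone_domain_le.
Proof.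
case=> [a|] [b|] //= /andP[/asboolP ab /asboolP ba].
by congr Some; apply/val_inj/cone_le_anti.
Qed.

Lemma cone_domain_le_trans : transitive cone_domain_le.
Proof.
case=> [b|] [a|] [c|] //= /asboolP ab /asboolP bc.
by apply/asboolP; exact: cone_le_trans ab bc.
Qed.

Fact cone_domain_display : Order.disp_t.
Proof. exact: Order.Disp tt tt. Qed.

HB.instance Definition _ := @Order.Le_isPOrder.Build cone_domain_display D
  cone_domain_le cone_domain_le_refl cone_domain_le_anti cone_domain_le_trans.

End ConeDomain.

(* Main.v *)
Require Import Defs.
From mathcomp Require Import all_boot all_order all_algebra perm.
From mathcomp Require Import boolp classical_sets functions cardinality.
From mathcomp Require Import reals interval_inference topology normedtype derive.
From mathcomp Require Import lra ring zify.

(** Choose a basis of [V] inside the cone; in its coordinates the cone becomes a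
set [K] of row vectors that contains the orthant, so that [e = (1, ..., 1)] is
an order unit.

FS. A directed set of nonpositive vectors converges to its supremum
([directed_limit]), because the functionals that are nonnegative on [K] span
the dual space. Hence [x - r e << x] for [r > 0], the poset is a continuous
dcpo, and the maps sending [x] to [x - e / n] when [x + n e] is interior to
[K], and to the bottom otherwise, are Scott-continuous and increase to the
identity. A grid of mesh [1 / n] separates the [n]-th one from the identity.

Simplicial implies RB. In the basis of its own generators the cone is the
orthant, and suprema are computed coordinatewise: the domain is a complete
lattice. A continuous complete lattice is a retract of a powerset, by
[x |-> {y | y << x}] and the supremum ([complete_domain_RB]).

RB implies simplicial. An RB-domain has monotone maps [f] of finite range with
[x - r e <= f x <= x] on a given box, for every [r > 0] ([RB_finite_map]).
Heuristically, the derivative of the step function [f] lives on the interfaces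
between its level sets, where it is [c (x) nu] with [c] in [K] (the jump) and
[nu] in the dual cone (the normal, since level sets are separated by upper
sets). As [f] is close to the identity, averaging makes the identity a limit of
sums of such positive rank-one maps. These sums form a closed cone, so the
identity is itself such a sum, and this forces [K] to be simplicial
([identity_sum_simplicial]).

The rigorous version is dual and discrete. If the identity is not such a sum,
separation gives a linear map [T] with negative trace that sends the nonzero
vectors of [K] into its interior ([simplicial_or_strictly_positive]). Move each
point [x] of a fine grid by [s T (f x)], rounded to the grid. If [x] and [y]
have the same image and [f x < f y], then [x - y] is close to [s T (f y - f x)],
so that [x >= y] and [f x >= f y], a contradiction. Collisions therefore only
occur between points at distance [O(s)] with incomparable values, and such a
point [x] satisfies [f (x - D e) <> f x <> f (x + D e)] for a [D] of order [s]
([moved_inj]). On the other hand [x + s T x] contracts volumes at the rate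
[s tr T < 0], which is felt by the sum of a bump function over the grid
([trace_le_isolated]). So the proportion of the exceptional points should not
be [o(s)]; but it is, for some scale [s]: if [A_D] counts the points where [f]
changes between [x] and [x + D e], and [B_D] those where it changes both
between [x] and [x + D e] and between [x + D e] and [x + 2 D e], then
[B_D + A_2D <= 2 A_D] up to a shift of the window, so that [B_D / D] is
summable over [D = 2^j D_0] ([few_double_changes]). *)

Set Implicit Arguments.
Unset Strict Implicit.
Unset Printing Implicit Defensive.

Import Order.TTheory GRing.Theory Num.Theory.
Import numFieldNormedType.Exports.

Local Open Scope classical_set_scope.
Local Open Scope ring_scope.

(** * Row vectors *)

Section RowVectors.
Variables (R : realDomainType) (d : nat).
Implicit Types x y : 'rV[R]_d.

Definition dotr x y : R := \sum_i x 0 i * y 0 i.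

Lemma dotrDl x y z : dotr (x + y) z = dotr x z + dotr y z.
Proof.
by rewrite -big_split; apply: eq_bigr => i _; rewrite mxE mulrDl.
Qed.

Lemma dotrC x y : dotr x y = dotr y x.
Proof. by apply: eq_bigr => i _; rewrite mulrC. Qed.

Lemma dotrDr x y z : dotr z (x + y) = dotr z x + dotr z y.
Proof. by rewrite dotrC dotrDl !(dotrC z). Qed.

Lemma dotrZl c x y : dotr (c *: x) y = c * dotr x y.
Proof. by rewrite mulr_sumr; apply: eq_bigr => i _; rewrite mxE mulrA. Qed.

Lemma dotrZr c x y : dotr x (c *: y) = c * dotr x y.
Proof. by rewrite dotrC dotrZl dotrC. Qed.

Lemma dotr_sumr (I : finType) x (y : I -> 'rV[R]_d) :
  dotr x (\sum_i y i) = \sum_i dotr x (y i).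
Proof.
rewrite /dotr [RHS]exchange_big; apply: eq_bigr => j _ /=.
by rewrite summxE mulr_sumr.
Qed.

Lemma dotrr_ge0 x : 0 <= dotr x x.
Proof. by apply: sumr_ge0 => i _; rewrite -expr2 sqr_ge0. Qed.

Lemma dotrr_eq0 x : dotr x x = 0 -> x = 0.
Proof.
move=> /eqP; rewrite psumr_eq0 => [/allP x0|i _]; last by rewrite -expr2 sqr_ge0.
apply/rowP => i; rewrite mxE; apply/eqP.
by have := x0 i (mem_index_enum i); rewrite /= -expr2 sqrf_eq0.
Qed.

Lemma dotr_mx x y : x *m y^T = (dotr x y)%:M.
Proof.
apply/matrixP => i j; rewrite !ord1 !mxE eqxx mulr1n.
by apply: eq_bigr => k _; rewrite mxE.
Qed.

Lemma sqr_coord_le x i : x 0 i ^+ 2 <= dotr x x.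
Proof.
rewrite /dotr (bigD1 i) //= expr2 lerDl; apply: sumr_ge0 => j _.
by rewrite -expr2 sqr_ge0.
Qed.

Lemma norm_coord_le1 x i : dotr x x <= 1 -> `|x 0 i| <= 1.
Proof.
move=> x1; rewrite -(@expr_le1 _ 2) // real_normK ?num_real //.
exact: le_trans (sqr_coord_le x i) x1.
Qed.

Definition mx_l1norm (T : 'M[R]_d) : R := \sum_i \sum_j `|T i j|.

Lemma norm_dotr_mulmx_le (T : 'M[R]_d) x y B :
  (forall i, `|x 0 i| <= 1) -> (forall i, `|y 0 i| <= B) ->
  `|dotr x (y *m T)| <= mx_l1norm T * B.
Proof.
move=> x1 yB.
have -> : dotr x (y *m T) = \sum_i \sum_j x 0 j * (y 0 i * T i j).
  rewrite exchange_big; apply: eq_bigr => j _; rewrite mxE mulr_sumr.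
  by apply: eq_bigr.
apply: le_trans (ler_norm_sum _ _ _) _.
rewrite /mx_l1norm mulr_suml; apply: ler_sum => i _.
apply: le_trans (ler_norm_sum _ _ _) _.
rewrite mulr_suml; apply: ler_sum => j _.
rewrite !normrM [leRHS]mulrC -[leRHS]mul1r.
rewrite ler_pM ?mulr_ge0 //.
by rewrite ler_wpM2r.
Qed.

Lemma norm_mulmx_coord_le (T : 'M[R]_d) y B j :
  (forall i, `|y 0 i| <= B) -> `|(y *m T) 0 j| <= mx_l1norm T * B.
Proof.
move=> yB; have := @norm_dotr_mulmx_le T (delta_mx 0 j) y B.
rewrite {1}/dotr (bigD1 j) //= mxE !eqxx mul1r big1 ?addr0.
  by apply => // i; rewrite mxE; case: (_ && _); rewrite ?normr1 ?normr0.
by move=> i ij; rewrite mxE (negPf ij) andbF mul0r.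
Qed.

Lemma mxtrace_l1norm (T : 'M[R]_d) : `|\tr T| <= mx_l1norm T.
Proof.
apply: le_trans (ler_norm_sum _ _ _) _; apply: ler_sum => i _.
by rewrite (bigD1 i) //= lerDl sumr_ge0.
Qed.

End RowVectors.

(** * Closed convex cones and their duals *)

Section Continuity.
Variable R : realType.

Lemma continuous_dotr (X : topologicalType) d (f g : X -> 'rV[R]_d) :
  (forall i, continuous (fun x => f x 0 i : R)) ->
  (forall i, continuous (fun x => g x 0 i : R)) ->
  continuous (fun x => dotr (f x) (g x)).
Proof.
move=> cf cg x; apply: cvg_big => [|i _]; first exact: add_continuous.
by apply: cvgM; [exact: cf|exact: cg].
Qed.

Lemma closed_dotr_ge0 d (c : 'rV[R]_d) : closed [set x : 'rV[R]_d | 0 <= dotr c x].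
Proof.
apply: (@preimage_closed _ _ (dotr c) [set y | 0 <= y]); last exact: closed_ge.
move=> x _; apply: continuous_dotr => i; first exact: cst_continuous.
exact: coord_continuous.
Qed.

Lemma coord_bounded_closed_compact d (A : set 'rV[R]_d) (B : R) :
  closed A -> (forall x, A x -> forall i, `|x 0 i| <= B) -> compact A.
Proof.
move=> Acl AB; pose I := [set y : R | `|y| <= B].
have cI : compact (`[- B, B]%classic : set R) by exact: segment_compact.
apply: subclosed_compact Acl (@rV_compact _ d (fun=> `[- B, B]%classic) _) _ => //.
by move=> x /AB xB i /=; rewrite in_itv /= -ler_norml.
Qed.

End Continuity.

Section NearestPoint.
Variables (R : realType) (d : nat).
Implicit Types x y : 'rV[R]_d.

(** The first-order condition at a minimum: for small [t] the linear term
dominates. *)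
Lemma quad_ge0_linear_ge0 (p r s : R) : 0 <= r -> 0 < s ->
  (forall t, 0 <= t -> t <= s -> 0 <= 2 * t * p + t ^+ 2 * r) -> 0 <= p.
Proof.
move=> r0 s0 H; rewrite leNgt; apply/negP => p0.
pose t := Num.min s (- p / (r + 1)).
have r1 : 0 < r + 1 by lra.
have t0 : 0 < t by rewrite lt_min s0 divr_gt0 // oppr_gt0.
have ts : t <= s by rewrite ge_min lexx.
have := H t (ltW t0) ts; rewrite -mulrA mulrCA expr2 -mulrA -mulrDr.
rewrite pmulr_rge0 //.
have : t * (r + 1) <= - p.
  by rewrite -ler_pdivlMr // ge_min lexx orbT.
have : 0 <= t * r by rewrite mulr_ge0 // ltW.
lra.
Qed.

Lemma dotrr_addZ x y t :
  dotr (x + t *: y) (x + t *: y) = dotr x x + (2 * t * dotr x y + t ^+ 2 * dotr y y).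
Proof.
by rewrite dotrDl !dotrDr !dotrZl !dotrZr [dotr y x]dotrC; ring.
Qed.

(** The vector from [x] to its nearest point in a convex cone is normal to that
cone: compare the nearest point [c0] with [c0 + t c] and with [(1 - t) c0]. *)
Lemma nearest_separates (S : set 'rV[R]_d) x c0 :
  (forall a b, S a -> S b -> S (a + b)) ->
  (forall t a, 0 <= t -> S a -> S (t *: a)) ->
  S c0 -> (forall c, S c -> dotr (c0 - x) (c0 - x) <= dotr (c - x) (c - x)) ->
  (forall c, S c -> 0 <= dotr (c0 - x) c) /\
  dotr (c0 - x) x = - dotr (c0 - x) (c0 - x).
Proof.
move=> Sadd Sscale Sc0 min; set w := c0 - x.
have pos c : S c -> 0 <= dotr w c.
  move=> Sc; apply: (@quad_ge0_linear_ge0 _ (dotr c c) 1) => //.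
    exact: dotrr_ge0.
  move=> t t0 _; have := min (c0 + t *: c) (Sadd _ _ Sc0 (Sscale _ _ t0 Sc)).
  by rewrite addrAC -/w dotrr_addZ; lra.
split=> //; suff w0 : dotr w c0 = 0.
  have -> : x = c0 + -1 *: w by rewrite scaleN1r opprB addrCA subrr addr0.
  by rewrite dotrDr dotrZr w0; ring.
apply/eqP; rewrite eq_le pos // andbT -oppr_ge0.
apply: (@quad_ge0_linear_ge0 _ (dotr c0 c0) 1) => //; first exact: dotrr_ge0.
move=> t t0 t1; have t1' : 0 <= 1 - t by rewrite subr_ge0.
have := min _ (Sscale _ _ t1' Sc0).
rewrite scalerBl scale1r addrAC -/w -scaleNr dotrr_addZ; lra.
Qed.

(** Apply [nearest_separates] at a nearest point, which exists by compactness. *)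
Lemma dual_cone_separates (K : set 'rV[R]_d) x :
  closed K -> K 0 -> (forall a b, K a -> K b -> K (a + b)) ->
  (forall t a, 0 <= t -> K a -> K (t *: a)) -> ~ K x ->
  exists2 nu, (forall c, K c -> 0 <= dotr nu c) & dotr nu x < 0.
Proof.
move=> Kcl K0 Kadd Kscale nKx.
pose f c := dotr (c - x) (c - x).
(* Only the points of [K] at least as close to [x] as 0 matter; they form a
   compact set. *)
pose A := K `&` [set c | f c <= dotr x x].
have cf : continuous f.
  have ci i : continuous (fun c : 'rV[R]_d => (c - x) 0 i : R).
    have -> : (fun c : 'rV[R]_d => (c - x) 0 i) =
        (fun c : 'rV[R]_d => c 0 i) \- cst (x 0 i).
      by apply/funext => c; rewrite !mxE.
    have c0 : continuous (fun c : 'rV[R]_d => c 0 i : R) by exact: coord_continuous.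
    by move=> y; apply: continuousB; [exact: c0|exact: cst_continuous].
  exact: continuous_dotr.
have Acl : closed A.
  apply: closedI => //.
  apply: (@preimage_closed _ _ f [set y | y <= dotr x x]); last exact: closed_le.
  by move=> y _; exact: cf.
have f0 : f 0 = dotr x x.
  by rewrite /f sub0r -scaleN1r dotrZl dotrZr mulrA mulrNN !mul1r.
have Abnd c : A c -> forall i, `|c 0 i| <= 2 * (dotr x x + 1).
  move=> [_ /= fc] i.
  have s0 : 0 <= dotr x x by exact: dotrr_ge0.
  have sq (y : R) : y ^+ 2 <= dotr x x -> `|y| <= dotr x x + 1.
    move=> h; rewrite -(@ler_pXn2r _ 2) ?nnegrE //; last by lra.
    rewrite real_normK ?num_real //; apply: le_trans h _; rewrite expr2; nra.
  have := sq _ (le_trans (sqr_coord_le (c - x) i) fc).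
  have := sq _ (sqr_coord_le x i).
  rewrite mxE [in X in `|_ + X|]mxE !ler_norml => /andP[? ?] /andP[? ?].
  by apply/andP; split; lra.
have Acpt := coord_bounded_closed_compact Acl Abnd.
have A0 : A !=set0 by exists 0; split => //=; rewrite f0.
have [c0 /set_mem[Kc0 fc0] min] :=
  EVT_min_rV A0 Acpt (continuous_subspaceT cf).
have [|wK wx] := @nearest_separates K x c0 Kadd Kscale Kc0.
- move=> c Kc; have [fc|fc] := leP (f c) (dotr x x).
    by apply: min; apply/mem_set; split.
  by apply: le_trans fc0 (ltW fc).
exists (c0 - x) => //; rewrite wx oppr_lt0 lt_neqAle dotrr_ge0 andbT eq_sym.
apply/eqP => /dotrr_eq0 /eqP; rewrite subr_eq0 => /eqP c0x.
by apply: nKx; rewrite -c0x.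
Qed.

End NearestPoint.

Section ProperCone.
Variables (R : realType) (d : nat).
Implicit Types (K : set 'rV[R]_d) (x y c nu : 'rV[R]_d).

(** The coordinates are always chosen such that the orthant is contained in the
cone, which makes the all-ones vector an order unit and lets coordinatewise
estimates be read as estimates for the cone order. *)
Record proper_cone K : Prop := ProperCone {
  proper_closed : closed K;
  proper_add : forall x y, K x -> K y -> K (x + y);
  proper_scale : forall (t : R) x, 0 <= t -> K x -> K (t *: x);
  proper_orthant : forall x, (forall i, 0 <= x 0 i) -> K x;
  proper_pointed : forall x, K x -> K (- x) -> x = 0 }.

Definition dual_cone K : set 'rV[R]_d :=
  [set nu | forall c, K c -> 0 <= dotr nu c].

Variable K : set 'rV[R]_d.
Hypothesis hK : proper_cone K.

Lemma proper0 : K 0.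
Proof. by apply: proper_orthant => // i; rewrite mxE. Qed.

Lemma proper_sum (I : finType) (P : pred I) (F : I -> 'rV[R]_d) :
  (forall i, P i -> K (F i)) -> K (\sum_(i | P i) F i).
Proof.
by move=> KF; elim/big_ind: _ => //; [exact: proper0|exact: (proper_add hK)].
Qed.

Lemma bidual x : (forall nu, dual_cone K nu -> 0 <= dotr nu x) -> K x.
Proof.
move=> pos; apply: contrapT => nKx.
have [nu nuK] := dual_cone_separates (proper_closed hK) proper0
  (proper_add hK) (proper_scale hK) nKx.
by rewrite ltNge pos.
Qed.

Lemma proper_archimedean x :
  (forall e, 0 < e -> K (x + const_mx e)) -> K x.
Proof.
move=> Kx; apply: bidual => nu nuK; rewrite leNgt; apply/negP => x0.
have nu1 : 0 <= dotr nu (const_mx 1).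
  by apply: nuK; apply: proper_orthant => // i; rewrite mxE.
pose e := - dotr nu x / (2 * (dotr nu (const_mx 1) + 1)).
have e0 : 0 < e by rewrite divr_gt0 ?oppr_gt0 //; lra.
have := nuK _ (Kx e e0).
have -> : const_mx e = e *: const_mx 1 :> 'rV[R]_d.
  by apply/rowP => i; rewrite !mxE mulr1.
rewrite dotrDr dotrZr leNgt => /negP; apply.
have : e * (2 * (dotr nu (const_mx 1) + 1)) = - dotr nu x.
  by rewrite /e divfK // gt_eqF //; lra.
nra.
Qed.

(** The dual of a closed pointed cone spans: if functionals that are nonnegative
on [K] have a common nonzero kernel vector [x], then [x] or [- x] is outside
[K], and a functional separating it from [K] is independent of them. *)
Lemma dual_independent r : (r <= d)%N ->
  exists M : 'M[R]_(r, d), row_free M /\ forall i, dual_cone K (row i M).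
Proof.
elim: r => [_|r IH rd].
  exists 0; split; last by case.
  by rewrite /row_free mxrank0.
have [M [Mfree Mdual]] := IH (ltnW rd).
have /rowV0Pn[x xM x0] : kermx M^T != 0.
  rewrite kermx_eq0 /row_free mxrank_tr (eqP Mfree).
  by rewrite neq_ltn rd.
have {}xM : x *m M^T = 0 by apply/sub_kermxP.
have [y yM nKy] : exists2 y, y *m M^T = 0 & ~ K y.
  have [Kx|] := pselect (K x); last by exists x.
  exists (- x); first by rewrite mulNmx xM oppr0.
  by move=> KNx; move/eqP: x0; apply; exact: (proper_pointed hK).
have [nu nuK nuy] := dual_cone_separates (proper_closed hK) proper0
  (proper_add hK) (proper_scale hK) nKy.
rewrite -[r.+1]/(1 + r)%N; exists (col_mx nu M); split; last first.
  move=> i; case: (split_ordP i) => j ->.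
    by rewrite rowKu ord1 row_id.
  by rewrite rowKd.
apply: inj_row_free => v; rewrite -[v]hsubmxK mul_row_col => v0.
have a0 : lsubmx v = 0.
  have := congr1 (mulmx^~ y^T) v0; rewrite mulmxDl mul0mx -!mulmxA.
  have -> : M *m y^T = 0 by rewrite -[LHS]trmxK trmx_mul trmxK yM trmx0.
  rewrite mulmx0 addr0 dotr_mx mul_mx_scalar => /eqP.
  by rewrite scaler_eq0 lt_eqF //= => /eqP.
move: v0; rewrite a0 mul0mx add0r => /eqP.
by rewrite mulmx_free_eq0 // => /eqP ->; rewrite row_mx0.
Qed.

(** Sums of a basis of dual vectors control all coordinates on the cone. In
particular [l] is positive on the nonzero vectors of [K]. *)
Lemma proper_functional : exists (l : 'rV[R]_d) (B : R),
  [/\ dual_cone K l, 0 < B & forall c, K c -> forall i, `|c 0 i| <= B * dotr l c].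
Proof.
have [M [Mfree Mdual]] := dual_independent (leqnn d).
have Munit : M^T \in unitmx by rewrite unitmx_tr -row_free_unit.
exists (\sum_i row i M), (mx_l1norm (invmx M^T) + 1).
have lE c : dotr (\sum_i row i M) c = \sum_i dotr (row i M) c.
  by rewrite dotrC dotr_sumr; apply: eq_bigr => i _; rewrite dotrC.
split.
- by move=> c Kc; rewrite lE; apply: sumr_ge0 => i _; exact: Mdual.
- by rewrite ltr_wpDl // sumr_ge0 // => i _; apply: sumr_ge0.
move=> c Kc j; set s := dotr _ c.
have s0 : 0 <= s by rewrite /s lE; apply: sumr_ge0 => i _; exact: Mdual.
have gi i : `|(c *m M^T) 0 i| <= s.
  have -> : (c *m M^T) 0 i = dotr (row i M) c.
    by rewrite dotrC mxE; apply: eq_bigr => k _; rewrite !mxE.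
  rewrite ger0_norm; last exact: Mdual.
  rewrite /s lE (bigD1 i) //= lerDl; apply: sumr_ge0 => k _; exact: Mdual.
have := @norm_mulmx_coord_le _ _ (invmx M^T) _ _ j gi.
by rewrite mulmxK //; move/le_trans; apply; rewrite ler_wpM2r //; lra.
Qed.

Lemma order_interval_bounded : exists2 B : R, 0 < B &
  forall x, K (const_mx 1 - x) -> K (const_mx 1 + x) -> forall i, `|x 0 i| <= B.
Proof.
have [l [B [lK B0 lB]]] := proper_functional.
have l1 : 0 <= dotr l (const_mx 1).
  by apply: lK; apply: proper_orthant => // i; rewrite mxE.
exists (1 + 2 * B * dotr l (const_mx 1)).
  by rewrite ltr_wpDr // !mulr_ge0 // ltW.
move=> x Kl Kr i; have := lB _ Kr i; have := lK _ Kl.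
rewrite dotrDr -scaleN1r dotrZr mulN1r subr_ge0 => h.
rewrite !mxE dotrDr; have : B * (dotr l (const_mx 1) + dotr l x) <=
  B * (2 * dotr l (const_mx 1)) by rewrite ler_wpM2l ?(ltW B0) //; lra.
rewrite !ler_norml => ? /andP[? ?]; apply/andP; split; lra.
Qed.

End ProperCone.

(** * Sums of rank-one positive maps *)

(** The theorem of Caratheodory for cones, needed to bound the number of rank-one
terms before a compactness argument is applied to them. *)
Section Caratheodory.
Variables (R : realFieldType) (m : nat) (P : 'rV[R]_m -> Prop).
Hypotheses (P0 : P 0) (PZ : forall t v, 0 <= t -> P v -> P (t *: v)).

Lemma caratheodory n (x : 'I_n -> 'rV[R]_m) : (forall i, P (x i)) ->
  exists2 y : 'I_m -> 'rV[R]_m, forall i, P (y i) & \sum_i x i = \sum_i y i.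
Proof.
elim: n x => [|n IH] x Px.
  by exists (fun=> 0) => //; rewrite big_ord0 sumr_const mul0rn.
have [nm|mn] := leqP n.+1 m.
  pose F i := if insub i is Some j then x j else 0.
  exists (fun i => if (i < n.+1)%N then F i else 0).
    by move=> i; rewrite /F; case: ifP => // _; case: insubP.
  rewrite -big_mkcond -(big_ord_widen _ F nm).
  by apply: eq_bigr => i _; rewrite /F valK.
pose X := \matrix_i x i.
have /rowV0Pn[a aX a0] : kermx X != 0.
  by rewrite kermx_eq0 /row_free neq_ltn (leq_ltn_trans (rank_leq_col X) mn).
have {}aX : a *m X = 0 by apply/sub_kermxP.
have [b [bX [j0 bj0]]] : exists b : 'rV[R]_n.+1,
    b *m X = 0 /\ exists j, 0 < b 0 j.
  have [j aj] : exists j, a 0 j != 0.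
    apply/existsP; apply: contraT; rewrite negb_exists => /forallP az.
    by case/eqP: a0; apply/rowP => j; rewrite mxE; apply/eqP/negPn.
  have [aj0|aj0] := ltP 0 (a 0 j); first by exists a; split => //; exists j.
  exists (- a); split; first by rewrite mulNmx aX oppr0.
  by exists j; rewrite mxE oppr_gt0 lt_neqAle aj.
(* Eliminating the term with the largest coefficient of the linear relation
   leaves the other coefficients [1 - b_i / b_k] nonnegative. *)
pose k := [arg max_(i > j0) b 0 i]%O.
have kmax i : b 0 i <= b 0 k.
  by rewrite /k; case: Order.TotalTheory.arg_maxP => // j _ /(_ i); apply.
have bk : 0 < b 0 k by apply: lt_le_trans (kmax j0).
have sumb : \sum_i b 0 i *: x i = 0.
  by rewrite -[RHS]bX mulmx_sum_row; apply: eq_bigr => i _; rewrite rowK.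
have [|y Py yE] := IH (fun i => (1 - b 0 (lift k i) / b 0 k) *: x (lift k i)).
  by move=> i; apply: PZ => //; rewrite subr_ge0 ler_pdivrMr // mul1r.
exists y => //; rewrite -yE.
have -> : \sum_i x i = \sum_i (1 - b 0 i / b 0 k) *: x i.
  under [RHS]eq_bigr do rewrite scalerBl scale1r mulrC -scalerA.
  by rewrite sumrB -scaler_sumr sumb scaler0 subr0.
by rewrite (bigD1_ord k) //= divff ?gt_eqF // subrr scale0r add0r.
Qed.

End Caratheodory.

Section PositiveMaps.
Variables (R : realType) (d : nat).
Implicit Types (K : set 'rV[R]_d) (x y c nu : 'rV[R]_d).

Lemma continuous_entry (T : topologicalType) (n : nat) (i : 'I_n) :
  continuous (fun v : 'rV[T]_n => v 0 i).
Proof.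
move=> v A /= vA.
exists (fun (_ : 'I_1) j => [set x | j = i -> A x]).
  move=> i' j; rewrite ord1.
  have [->|/eqP ji] := eqVneq j i; last by apply: filterE => x /ji.
  by apply: filterS vA => x Ax _.
by move=> w /(_ 0 i); apply.
Qed.

Lemma continuous_entry2 (n : nat) (i : 'I_n) (j : 'I_d) :
  continuous (fun N : 'rV['rV[R]_d]_n => N 0 i 0 j : R).
Proof.
move=> N; have h : continuous (fun x : 'rV[R]_d => x 0 j : R).
  exact: coord_continuous.
exact: (@continuous_comp _ _ _ (fun N : 'rV['rV[R]_d]_n => N 0 i)
  (fun x : 'rV[R]_d => x 0 j) N (@continuous_entry _ _ i N) (h _)).
Qed.

Variable K : set 'rV[R]_d.
Hypothesis hK : proper_cone K.

Lemma dual_cone_scale (t : R) nu : 0 <= t -> dual_cone K nu -> dual_cone K (t *: nu).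
Proof. by move=> t0 nuK c Kc; rewrite dotrZl mulr_ge0 // nuK. Qed.

Lemma dual_cone0 : dual_cone K 0.
Proof. by move=> c Kc; rewrite /dotr big1 // => i _; rewrite mxE mul0r. Qed.

Definition rank1 nu c : 'rV[R]_(d * d) := mxvec (nu^T *m c).

Lemma dotr_mulmxl x y (A : 'M[R]_d) : dotr (x *m A) y = dotr x (y *m A^T).
Proof.
have : (dotr (x *m A) y)%:M = (dotr x (y *m A^T))%:M :> 'M_1.
  by rewrite -!dotr_mx trmx_mul trmxK mulmxA.
by move=> /matrixP/(_ 0 0); rewrite !mxE.
Qed.

Lemma dotr_rank1 (w : 'rV[R]_(d * d)) nu c :
  dotr w (rank1 nu c) = dotr (nu *m vec_mx w) c.
Proof.
have := mxvec_dotmul (vec_mx w) nu c; rewrite vec_mxK !dotr_mx => /matrixP/(_ 0 0).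
by rewrite !mxE eqxx !mulr1n dotrC.
Qed.

Lemma rank1Z t nu c : rank1 nu (t *: c) = t *: rank1 nu c.
Proof. by rewrite /rank1 -scalemxAr linearZ. Qed.

Lemma rank1Zl t nu c : rank1 (t *: nu) c = t *: rank1 nu c.
Proof. by rewrite /rank1 linearZ /= -scalemxAl linearZ. Qed.

(** The matrices [\sum_i (nu i)^T *m c i] with [nu i] in the dual cone and [c i]
in [K], as vectors. The [d * d] terms suffice by [caratheodory], so that these
matrices form a convex cone. *)
Definition separable : set 'rV[R]_(d * d) :=
  [set v | exists2 y : 'I_(d * d) -> 'rV[R]_(d * d),
     forall i, exists nu c, [/\ dual_cone K nu, K c & y i = rank1 nu c] &
     v = \sum_i y i].

Let P (v : 'rV[R]_(d * d)) := exists nu c, [/\ dual_cone K nu, K c & v = rank1 nu c].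

Let P0 : P 0.
Proof.
exists 0, 0; split; [exact: dual_cone0|exact: proper0|].
by rewrite /rank1 mulmx0 linear0.
Qed.

Let PZ t v : 0 <= t -> P v -> P (t *: v).
Proof.
move=> t0 [nu [c [nuK Kc ->]]]; exists nu, (t *: c).
by split=> //; [exact: proper_scale|rewrite rank1Z].
Qed.

Lemma separable_add v w : separable v -> separable w -> separable (v + w).
Proof.
move=> [x Px ->] [y Py ->].
pose z (i : 'I_(d * d + d * d)) := match fintype.split i with inl j => x j | inr j => y j end.
have Pz i : P (z i) by rewrite /z; case: (fintype.split i).
have [u Pu E] := caratheodory P0 PZ Pz.
exists u => //; rewrite -E big_split_ord /=.
by congr (_ + _); apply: eq_bigr => i _; rewrite /z;
  [rewrite (unsplitK (inl i)) | rewrite (unsplitK (inr i))].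
Qed.

Lemma separable_scale (t : R) v : 0 <= t -> separable v -> separable (t *: v).
Proof.
move=> t0 [x Px ->]; exists (fun i => t *: x i); last by rewrite scaler_sumr.
by move=> i; exact: PZ.
Qed.

Local Notation id_vec := (mxvec (1%:M : 'M[R]_d)).

(** The cone [separable] is closed, in the form in which it is used: it has a
point nearest to the identity. Normalising [l c <= 1] in each term, a matrix
that is at least as close to the identity as 0 comes from parameters in a
compact set, on which the distance attains its minimum. *)
Lemma separable_nearest : exists2 s, separable s &
  forall v, separable v -> dotr (s - id_vec) (s - id_vec) <= dotr (v - id_vec) (v - id_vec).
Proof.
have [l [C [lK C0 lC]]] := proper_functional hK.
set e : 'rV[R]_d := const_mx 1.
have Ke : K e by apply: (proper_orthant hK) => i; rewrite mxE.
set a := rank1 e l.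
(* The form [dotr a] sends [nu^T *m c] to [nu e * l c], hence it bounds all
   the [nu e] once the vectors [c] are normalised. *)
pose B := dotr a a + 4 * dotr id_vec id_vec.
have B0 : 0 <= B by rewrite addr_ge0 ?mulr_ge0 ?dotrr_ge0.
pose D1 := dual_cone K `&` [set nu | dotr nu e <= B].
pose D2 := K `&` [set c | dotr l c <= 1].
have clhalf z (b : R) : closed [set x : 'rV[R]_d | dotr z x <= b].
  apply: (@preimage_closed _ _ (dotr z) [set y | y <= b]); last exact: closed_le.
  move=> x _; apply: continuous_dotr => i; first exact: cst_continuous.
  exact: coord_continuous.
have cD1 : compact D1.
  apply: (@coord_bounded_closed_compact _ _ _ B).
    apply: closedI; last first.
      by under eq_set => nu do rewrite dotrC; exact: clhalf.
    have -> : dual_cone K = \bigcap_(c in K) [set nu | 0 <= dotr c nu].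
      apply/seteqP; split=> nu /= h c Kc; first by rewrite /= dotrC; exact: h.
      by have := h _ Kc; rewrite /= dotrC.
    by apply: closed_bigI => c _; exact: closed_dotr_ge0.
  move=> nu [nuK /= nuB] i.
  have coord j : 0 <= nu 0 j.
    have Kj : K (delta_mx 0 j).
      by apply: (proper_orthant hK) => k; rewrite mxE; case: (_ && _).
    have := nuK _ Kj; rewrite /dotr (bigD1 j) //= mxE !eqxx mulr1 big1 ?addr0 //.
    by move=> k kj; rewrite mxE (negPf kj) mulr0.
  rewrite ger0_norm //; apply: le_trans nuB.
  rewrite /dotr (bigD1 i) //= mxE mulr1 lerDl; apply: sumr_ge0 => j _.
  by rewrite mxE mulr1.
have cD2 : compact D2.
  apply: (@coord_bounded_closed_compact _ _ _ C).
    by apply: closedI; [exact: proper_closed|exact: clhalf].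
  move=> c [Kc /= c1] i; apply: le_trans (lC _ Kc i) _.
  by rewrite -[leRHS]mulr1 ler_wpM2l // ltW.
pose param := ('rV['rV[R]_d]_(d * d) * 'rV['rV[R]_d]_(d * d))%type.
pose A : set param := [set N : 'rV['rV[R]_d]_(d * d) | forall i, D1 (N 0 i)] `*`
  [set X : 'rV['rV[R]_d]_(d * d) | forall i, D2 (X 0 i)].
have cA : compact A.
  apply: compact_setX.
    by apply: (@rV_compact _ (d * d) (fun=> D1)) => _.
  by apply: (@rV_compact _ (d * d) (fun=> D2)) => _.
pose g (p : param) : 'rV[R]_(d * d) := \sum_i rank1 (p.1 0 i) (p.2 0 i).
pose f p := dotr (g p - id_vec) (g p - id_vec).
have cf : continuous f.
  have cg k : continuous (fun p : param => (g p - id_vec) 0 k).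
    case: (mxvec_indexP k) => i j.
    have -> : (fun p : param => (g p - id_vec) 0 (mxvec_index i j)) =
        (fun p : param => \sum_s (p.1 0 s) 0 i * (p.2 0 s) 0 j) \- cst ((1%:M : 'M[R]_d) i j).
      apply/funext => p; rewrite mxE [X in _ + X]mxE mxvecE /g summxE /=.
      congr (_ - _); apply: eq_bigr => s _.
      by rewrite mxvecE mxE big_ord1 mxE.
    move=> p; apply: continuousB; last exact: cst_continuous.
    apply: cvg_big => [|s _]; first exact: add_continuous.
    apply: continuousM.
      exact: (continuous_comp cvg_fst (@continuous_entry2 _ s i _)).
    exact: (continuous_comp cvg_snd (@continuous_entry2 _ s j _)).
  exact: continuous_dotr.
pose p1 : param := (const_mx 0, const_mx 0).
have A0 : A p1.
  split=> i; rewrite mxE; split => /=; rewrite ?/dotr ?big1 //.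
  - exact: dual_cone0.
  - by move=> j _; rewrite mxE mul0r.
  - exact: proper0.
  - by move=> j _; rewrite mxE mulr0.
have f0 : f p1 = dotr id_vec id_vec.
  rewrite /f /g big1 => [|i _]; last first.
    by rewrite /p1 /= [X in rank1 _ X]mxE /rank1 mulmx0 linear0.
  by rewrite sub0r -scaleN1r dotrZl dotrZr mulrA mulrNN !mul1r.
have [p0 /set_mem Ap0 min] := compact_EVT_min (ex_intro _ _ A0) cA
  (continuous_subspaceT cf).
exists (g p0).
  exists (fun i => rank1 (p0.1 0 i) (p0.2 0 i)) => // i.
  by have [/(_ i)[? _] /(_ i)[? _]] := Ap0; exists (p0.1 0 i), (p0.2 0 i).
move=> v Sv; have [big|small] := ltP (dotr id_vec id_vec) (dotr (v - id_vec) (v - id_vec)).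
  by apply: le_trans (ltW big); rewrite -f0; apply: min; apply/mem_set.
have [y Py vE] := Sv.
have norm i : exists p : 'rV[R]_d * 'rV[R]_d, [/\ dual_cone K p.1, D2 p.2,
    y i = rank1 p.1 p.2 & dotr p.1 e = dotr a (y i)].
  have [nu [c [nuK Kc yE]]] := Py i.
  have aE : dotr a (y i) = dotr nu e * dotr l c.
    rewrite yE dotr_rank1 /a /rank1 mxvecK mulmxA dotr_mx mul_scalar_mx dotrZl.
    by [].
  have lc := lK _ Kc.
  (* Terms with [l c = 0] vanish; the others are rescaled to [l c = 1]. *)
  have [lc0|lc0] := eqVneq (dotr l c) 0.
    have c0 : c = 0.
      apply/rowP => j; rewrite mxE; apply/eqP; rewrite -normr_le0.
      by have := lC _ Kc j; rewrite lc0 mulr0.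
    exists (0, 0); split => /=.
    - exact: dual_cone0.
    - by split; [exact: proper0|rewrite /= /dotr big1 // => j _; rewrite mxE mulr0].
    - by rewrite yE c0 /rank1 !mulmx0.
    - by rewrite aE lc0 mulr0 /dotr big1 // => j _; rewrite mxE mul0r.
  exists (dotr l c *: nu, (dotr l c)^-1 *: c); split => /=.
  - exact: dual_cone_scale.
  - split; first by apply: (proper_scale hK) => //; rewrite invr_ge0.
    by rewrite /= dotrZr mulVf.
  - by rewrite rank1Z rank1Zl scalerA mulVf // scale1r.
  - by rewrite aE dotrZl mulrC.
have [q qP] := choice norm.
have Bv : \sum_i dotr (q i).1 e <= B.
  have -> : \sum_i dotr (q i).1 e = dotr a v.
    by rewrite vE dotr_sumr; apply: eq_bigr => i _; case: (qP i).
  have h1 := dotrr_ge0 (a + -1 *: v).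
  have h2 := dotrr_ge0 (v + -2 *: id_vec).
  have small' : dotr (v + -1 *: id_vec) (v + -1 *: id_vec) <= dotr id_vec id_vec.
    by rewrite scaleN1r.
  have h3 := dotrr_ge0 a; have h4 := dotrr_ge0 id_vec.
  move: h1 h2 small'; rewrite /B !dotrr_addZ; lra.
pose p2 : param := (\row_i (q i).1, \row_i (q i).2).
have Aq : A p2.
  split=> i; rewrite mxE; have [h1 h2 _ _] := qP i => //; split => //=.
  apply: le_trans Bv; rewrite (bigD1 i) //= lerDl; apply: sumr_ge0 => j _.
  by have [nuK _ _ _] := qP j; exact: nuK.
have -> : v = g p2.
  by rewrite vE /g; apply: eq_bigr => i _; rewrite !mxE; case: (qP i).
by apply: min; apply/mem_set.
Qed.

(** Otherwise the vector from the identity to its nearest point, transposed, is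
the required [T]: nonnegativity on the rank-one matrices says that [T] maps [K]
into its bidual, and the pairing with the identity is the trace. *)
Lemma separable_identity_or_negative_trace :
  separable id_vec \/
  exists2 T : 'M[R]_d, \tr T < 0 & forall c, K c -> K (c *m T).
Proof.
have [s Ss min] := separable_nearest.
have [pos wid] := nearest_separates separable_add separable_scale Ss min.
set w := s - id_vec in pos wid.
have [w0|w0] := eqVneq w 0.
  by left; have /eqP := w0; rewrite subr_eq0 => /eqP <-.
right; exists (vec_mx w)^T; last first.
  move=> c Kc; apply: (bidual hK) => nu nuK.
  have Snc : separable (rank1 nu c).
    have P1 (i : 'I_1) : P (rank1 nu c) by exists nu, c.
    have [y Py yE] := caratheodory P0 PZ P1.
    by exists y => //; rewrite -yE big_ord1.
  have := pos _ Snc; rewrite dotr_rank1.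
  by rewrite dotr_mulmxl.
rewrite mxtrace_tr.
suff -> : \tr (vec_mx w) = dotr w id_vec.
  rewrite wid oppr_lt0 lt_neqAle dotrr_ge0 andbT eq_sym.
  by apply/eqP => /dotrr_eq0 /eqP; apply/negP.
rewrite mx1_sum_delta linear_sum /=.
rewrite dotr_sumr; apply: eq_bigr => i _.
rewrite -(mul_delta_mx (0 : 'I_1)) -trmx_delta -/(rank1 _ _).
rewrite dotr_rank1 -rowE /dotr (bigD1 i) //= big1 ?addr0.
  by rewrite !mxE !eqxx mulr1.
by move=> j ji; rewrite [X in _ * X]mxE (negPf ji) mulr0.
Qed.

End PositiveMaps.

(** * Cones on which the identity is a sum of positive rank-one maps *)

Section SimplicialCone.
Variables (R : realType) (d : nat) (K : set 'rV[R]_d).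
Hypothesis hK : proper_cone K.
Implicit Types (x y : 'rV[R]_d).

Lemma identity_sum_expand n (nu c : 'I_n -> 'rV[R]_d) x :
  1%:M = \sum_i (nu i)^T *m c i -> x = \sum_i dotr x (nu i) *: c i.
Proof.
move=> id; rewrite -[LHS]mulmx1 id mulmx_sumr; apply: eq_bigr => i _.
by rewrite mulmxA dotr_mx mul_scalar_mx.
Qed.

(** If no [c i] is in the cone spanned by the others, then in the expansion of
[c i] itself the coefficient of [c i] must be 1 (if it is smaller, [c i] is a
combination of the others; if it is larger, [- c i] is in [K]), and the
remaining terms, which are elements of [K] with sum 0, vanish. *)
Lemma identity_sum_biorthogonal n (nu c : 'I_n.+1 -> 'rV[R]_d) :
  (forall i, dual_cone K (nu i)) -> (forall i, K (c i)) ->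
  1%:M = \sum_i (nu i)^T *m c i ->
  (forall (i : 'I_n.+1) (a : 'I_n -> R), (forall j, 0 <= a j) ->
     c i <> \sum_j a j *: c (lift i j)) ->
  forall i j, dotr (c i) (nu j) = (i == j)%:R.
Proof.
move=> nuK cK id irr i.
have g0 j : 0 <= dotr (c i) (nu j) by rewrite dotrC; exact: nuK.
pose z := \sum_j dotr (c i) (nu (lift i j)) *: c (lift i j).
have Kterm j : K (dotr (c i) (nu (lift i j)) *: c (lift i j)).
  by apply: (proper_scale hK).
have Kz : K z by apply: (proper_sum hK).
have E : c i = dotr (c i) (nu i) *: c i + z.
  by rewrite {1}(identity_sum_expand (c i) id) (bigD1_ord i).
have zE : z = (1 - dotr (c i) (nu i)) *: c i.
  by rewrite scalerBl scale1r {1}E addrAC subrr add0r.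
have cn0 k : c k != 0.
  apply/eqP => ck; apply: (irr k (fun=> 0)) => //.
  by rewrite ck big1 // => j _; rewrite scale0r.
have gi : dotr (c i) (nu i) = 1.
  have [lt|gt|//] := ltgtP (dotr (c i) (nu i)) 1.
    case: (irr i (fun j => (1 - dotr (c i) (nu i))^-1 * dotr (c i) (nu (lift i j)))).
      by move=> j; rewrite mulr_ge0 // invr_ge0 subr_ge0 ltW.
    under eq_bigr do rewrite -scalerA.
    rewrite -scaler_sumr -/z zE scalerA mulVf ?scale1r //.
    by rewrite subr_eq0 gt_eqF.
  have : c i = 0.
    apply: (proper_pointed hK) => //.
    have -> : - c i = (dotr (c i) (nu i) - 1)^-1 *: z.
      rewrite zE scalerA -[1 - _]opprB mulrN mulVf ?scaleN1r //.
      by rewrite subr_eq0 gt_eqF.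
    by apply: (proper_scale hK) => //; rewrite invr_ge0 subr_ge0 ltW.
  by move/eqP; rewrite (negPf (cn0 i)).
have z0 : z = 0 by rewrite zE gi subrr scale0r.
have gj j : dotr (c i) (nu (lift i j)) = 0.
  have : dotr (c i) (nu (lift i j)) *: c (lift i j) = 0.
    apply: (proper_pointed hK) => //.
    have -> : - (dotr (c i) (nu (lift i j)) *: c (lift i j)) =
        \sum_(k | k != j) dotr (c i) (nu (lift i k)) *: c (lift i k).
      have := z0; rewrite /z (bigD1 j) //= addrC => /eqP.
      by rewrite addr_eq0 => /eqP ->.
    by apply: (proper_sum hK).
  by move/eqP; rewrite scaler_eq0 (negPf (cn0 _)) orbF => /eqP.
move=> j; have [<-|ij] := eqVneq i j; first by rewrite gi.
by have [k -> _] := unlift_some ij; rewrite gj.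
Qed.

(** A redundant [c i] can be substituted away, merging its functional into those
of the others. When none is left, [c] and [nu] are biorthogonal, hence [c] is a
basis, and the coordinates [nu i] of a vector of [K] are nonnegative. *)
Lemma identity_sum_simplicial n (nu c : 'I_n -> 'rV[R]_d) :
  (forall i, dual_cone K (nu i)) -> (forall i, K (c i)) ->
  1%:M = \sum_i (nu i)^T *m c i ->
  exists2 B : 'M[R]_d, B \in unitmx &
    K = [set x | exists2 t : 'rV[R]_d, forall i, 0 <= t 0 i & x = t *m B].
Proof.
elim: n nu c => [|n IH] nu c nuK cK id.
  have d0 : d = 0%N.
    case: (posnP d) => // d0; move: id; rewrite big_ord0 => /matrixP.
    move=> /(_ (Ordinal d0) (Ordinal d0)) /eqP.
    by rewrite !mxE eqxx oner_eq0.
  exists 1%:M; first exact: unitmx1.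
  apply/seteqP; split=> x /= h.
    exists x; last by rewrite mulmx1.
    by move=> i; have := ltn_ord i; rewrite {2}d0.
  by apply: (proper_orthant hK) => i; have := ltn_ord i; rewrite {2}d0.
have [[i [a [a0 ci]]]|irr] := pselect (exists (i : 'I_n.+1) (a : 'I_n -> R),
    (forall j, 0 <= a j) /\ c i = \sum_j a j *: c (lift i j)).
  apply: (IH (fun j => nu (lift i j) + a j *: nu i) (fun j => c (lift i j))).
  - move=> j x Kx; rewrite dotrDl dotrZl addr_ge0 ?mulr_ge0 //; exact: nuK.
  - by move=> j.
  rewrite id (bigD1_ord i) //= ci mulmx_sumr -big_split; apply: eq_bigr => j _ /=.
  by rewrite [in RHS]linearD [in RHS]linearZ /= mulmxDl addrC -[in RHS]scalemxAl
    -scalemxAr.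
have biorth := identity_sum_biorthogonal nuK cK id (fun i a a0 e =>
  irr (ex_intro _ i (ex_intro _ a (conj a0 e)))).
pose C := \matrix_i c i; pose N := \matrix_i nu i.
have NC : N^T *m C = 1%:M.
  rewrite id; apply/matrixP => i j; rewrite mxE summxE; apply: eq_bigr => k _.
  by rewrite !mxE big_ord1 !mxE.
have CN : C *m N^T = 1%:M.
  apply/matrixP => i j; rewrite [RHS]mxE -biorth mxE; apply: eq_bigr => k _.
  by rewrite !mxE.
have dn : d = n.+1.
  by apply/eqP; rewrite eqn_leq (mulmx1_min NC) (mulmx1_min CN).
have KE : K = [set x | exists2 t : 'rV[R]_n.+1, forall i, 0 <= t 0 i & x = t *m C].
  apply/seteqP; split=> x /=.
    move=> Kx; exists (x *m N^T); last by rewrite -mulmxA NC mulmx1.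
    move=> i; have -> : (x *m N^T) 0 i = dotr (nu i) x; last exact: nuK.
    by rewrite mxE; apply: eq_bigr => k _; rewrite !mxE mulrC.
  move=> [t t0 ->]; rewrite mulmx_sum_row; apply: (proper_sum hK) => i _.
  by rewrite rowK; apply: (proper_scale hK).
move: C N NC CN KE; rewrite -dn => C N NC CN KE.
by exists C => //; have [] := mulmx1_unit CN.
Qed.

Lemma separable_simplicial : separable K (mxvec 1%:M) ->
  exists2 B : 'M[R]_d, B \in unitmx &
    K = [set x | exists2 t : 'rV[R]_d, forall i, 0 <= t 0 i & x = t *m B].
Proof.
move=> [y yP id].
have yP' i : exists p : 'rV[R]_d * 'rV[R]_d,
    [/\ dual_cone K p.1, K p.2 & y i = rank1 p.1 p.2].
  by have [nu [c H]] := yP i; exists (nu, c).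
have [p pP] := choice yP'.
apply: (@identity_sum_simplicial _ (fun i => (p i).1) (fun i => (p i).2)).
- by move=> i; case: (pP i).
- by move=> i; case: (pP i).
apply: (can_inj mxvecK); rewrite id linear_sum; apply: eq_bigr => i _.
by case: (pP i).
Qed.

(** A small multiple of the rank-one map [c |-> l c * e] makes [T] strictly
positive without making its trace nonnegative. *)
Lemma simplicial_or_strictly_positive :
  (exists2 B : 'M[R]_d, B \in unitmx &
    K = [set x | exists2 t : 'rV[R]_d, forall i, 0 <= t 0 i & x = t *m B]) \/
  exists2 T : 'M[R]_d, \tr T < 0 &
    forall c, K c -> c != 0 -> exists2 r : R, 0 < r & K (c *m T - const_mx r).
Proof.
have [/separable_simplicial|[T trT TK]] := separable_identity_or_negative_trace hK.
  by left.
right; have [l [B [lK B0 lB]]] := proper_functional hK.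
set e : 'rV[R]_d := const_mx 1.
have le : 0 <= dotr l e.
  by apply: lK; apply: (proper_orthant hK) => i; rewrite mxE.
pose eta := - \tr T / (2 * (dotr l e + 1)).
have eta0 : 0 < eta by rewrite divr_gt0 ?oppr_gt0 //; lra.
exists (T + eta *: (l^T *m e)).
  rewrite mxtraceD mxtraceZ mxtrace_mulC dotr_mx mxtrace_scalar mulr1n dotrC.
  have : eta * (2 * (dotr l e + 1)) = - \tr T by rewrite /eta divfK // gt_eqF //; lra.
  nra.
move=> c Kc c0; exists (eta * dotr l c).
  rewrite mulr_gt0 // lt_neqAle lK // andbT eq_sym; apply: contra c0 => /eqP lc.
  apply/eqP/rowP => i; rewrite mxE; apply/eqP; rewrite -normr_le0.
  by have := lB _ Kc i; rewrite lc mulr0.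
have -> : const_mx (eta * dotr l c) = (eta * dotr l c) *: e.
  by apply/rowP => i; rewrite !mxE mulr1.
rewrite mulmxDr -scalemxAr mulmxA dotr_mx mul_scalar_mx scalerA dotrC addrK.
exact: TK.
Qed.

End SimplicialCone.

(** * Counting colour changes of a monotone colouring of a grid *)

Section MonotoneColouring.
Local Open Scope order_scope.
Local Open Scope nat_scope.

Lemma leq_sum_inj (A B : finType) (f : A -> B) (F : B -> nat) :
  injective f -> \sum_a F (f a) <= \sum_b F b.
Proof.
move=> injf; rewrite -(big_imset F (A := A)) /=; last by move=> x y _ _ /injf.
rewrite [leqRHS](bigID (mem (f @: A))) /=.
exact: leq_addr.
Qed.

Variables (d : nat).
Implicit Types (k l : {ffun 'I_d -> nat}) (L D : nat).

(** Cubes of all sizes are embedded in the same set of integer points, so that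
sums over a cube and over its shifts can be compared. *)
Definition cube_point L (k : {ffun 'I_d -> 'I_L}) : {ffun 'I_d -> nat} :=
  [ffun i => val (k i)].

Definition diag_shift D k : {ffun 'I_d -> nat} := [ffun i => k i + D].

Lemma diag_shiftD D D' k :
  diag_shift D (diag_shift D' k) = diag_shift (D' + D) k.
Proof. by apply/ffunP => i; rewrite !ffunE addnA. Qed.

Lemma sum_cube_shift L D (g : {ffun 'I_d -> nat} -> nat) :
  \sum_(k : {ffun 'I_d -> 'I_L}) g (diag_shift D (cube_point k)) <=
  \sum_(k : {ffun 'I_d -> 'I_(D + L)}) g (cube_point k).
Proof.
pose f (k : {ffun 'I_d -> 'I_L}) : {ffun 'I_d -> 'I_(D + L)} :=
  [ffun i => rshift D (k i)].
have injf : injective f.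
  move=> k l /ffunP kl; apply/ffunP => i; apply: (@rshift_inj D).
  by have := kl i; rewrite !ffunE.
rewrite -[leqRHS]/(\sum_k _); apply: leq_trans (leq_sum_inj _ injf).
apply: leq_sum => k _; suff -> : diag_shift D (cube_point k) = cube_point (f k).
  by [].
by apply/ffunP => i; rewrite !ffunE /= addnC.
Qed.

Lemma sum_cube_widen L L' (g : {ffun 'I_d -> nat} -> nat) : L <= L' ->
  \sum_(k : {ffun 'I_d -> 'I_L}) g (cube_point k) <=
  \sum_(k : {ffun 'I_d -> 'I_L'}) g (cube_point k).
Proof.
move=> LL'.
pose f (k : {ffun 'I_d -> 'I_L}) : {ffun 'I_d -> 'I_L'} :=
  [ffun i => widen_ord LL' (k i)].
have injf : injective f.
  move=> k l /ffunP kl; apply/ffunP => i.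
  by have := kl i; rewrite !ffunE => /(congr1 val)/= /val_inj.
apply: leq_trans (leq_sum_inj _ injf).
apply: leq_sum => k _; suff -> : cube_point k = cube_point (f k) by [].
by apply/ffunP => i; rewrite !ffunE.
Qed.

Lemma subn_expn_le (L D e : nat) :
  (L + D) ^ e - L ^ e <= e * D * (L + D) ^ e.-1.
Proof.
elim: e => [|e IH]; first by rewrite !expn0 subnn.
rewrite leq_subLR /= !expnS mulnDl.
have : L * (L + D) ^ e <= L * (L ^ e + e * D * (L + D) ^ e.-1).
  by rewrite leq_mul2l -leq_subLR IH orbT.
case: e {IH} => [|e] /=; first by rewrite !expn0; lia.
rewrite !mulnDr => /leq_trans-/(_ (L * L ^ e.+1 + e.+1 * D * (L + D) ^ e.+1)).
move=> H; have {H}: L * (L + D) ^ e.+1 <=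
    L * L ^ e.+1 + e.+1 * D * (L + D) ^ e.+1.
  apply: H; rewrite leq_add2l expnS mulnCA leq_mul2l; apply/orP; right.
  by rewrite leq_mul2r leq_addr orbT.
lia.
Qed.

Variables (disp : Order.disp_t) (W : porderType disp).
Variables (G : {ffun 'I_d -> nat} -> W) (N : nat) (rk : W -> nat).
Hypothesis G_mono : forall k l, (forall i, k i <= l i) -> (G k <= G l)%O.
Hypothesis rk_le : forall k, rk (G k) <= N.
Hypothesis rk_lt : forall k l, (G k < G l)%O -> rk (G k) < rk (G l).

Definition changes D k : bool := G k != G (diag_shift D k).

Definition num_changes D L :=
  \sum_(k : {ffun 'I_d -> 'I_L}) (changes D (cube_point k) : nat).

Definition num_double_changes D L :=
  \sum_(k : {ffun 'I_d -> 'I_L})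
    (changes D (cube_point k) && changes D (diag_shift D (cube_point k)) : nat).

Lemma G_shift_le D k : (G k <= G (diag_shift D k))%O.
Proof. by apply: G_mono => i; rewrite ffunE leq_addr. Qed.

(** By monotonicity, [G] changes between [k] and [k + 2 D] as soon as it changes
in one of the two halves; so changes in both halves are counted once on the
scale [2 D] but twice on the scale [D]. *)
Lemma double_changes_le D L :
  num_double_changes D L + num_changes (D + D) L <= 2 * num_changes D (D + L).
Proof.
have -> : num_double_changes D L + num_changes (D + D) L =
    num_changes D L +
    \sum_(k : {ffun 'I_d -> 'I_L}) changes D (diag_shift D (cube_point k)).
  rewrite /num_double_changes /num_changes -!big_split /=.
  apply: eq_bigr => k _; rewrite /changes diag_shiftD; set x := cube_point k.
  have [e1|n1] := eqVneq (G x) (G (diag_shift D x)); first by rewrite -e1.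
  have [e2|n2] := eqVneq (G (diag_shift D x)) (G (diag_shift (D + D) x)) => /=.
    by rewrite -e2 n1.
  suff -> : G x != G (diag_shift (D + D) x) by [].
  apply: contra n1 => /eqP e; apply/eqP/le_anti; rewrite G_shift_le /=.
  by rewrite e -diag_shiftD G_shift_le.
rewrite mul2n -addnn leq_add //.
- by apply: (sum_cube_widen (fun k => changes D k : nat)); rewrite leq_addl.
- exact: (sum_cube_shift L D (fun k => changes D k : nat)).
Qed.

(** Each change raises the rank, and the sums of the ranks over a cube and over
its shift differ by boundary terms only. *)
Lemma num_changes_le D L :
  num_changes D L <= N * (d * D * (D + L) ^ d.-1).
Proof.
have cardQ M : \sum_(k : {ffun 'I_d -> 'I_M}) N = N * M ^ d.
  by rewrite sum_nat_const mulnC card_ffun !card_ord.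
apply: leq_trans (_ : N * ((L + D) ^ d - L ^ d) <= _); last first.
  by rewrite leq_mul2l [D + L]addnC subn_expn_le orbT.
have h1 : num_changes D L +
    \sum_(k : {ffun 'I_d -> 'I_L}) rk (G (cube_point k)) <=
    \sum_(k : {ffun 'I_d -> 'I_L}) rk (G (diag_shift D (cube_point k))).
  rewrite /num_changes -big_split /=; apply: leq_sum => k _.
  rewrite /changes; set x := cube_point k.
  have [->|n1] := eqVneq (G x) (G (diag_shift D x)); first by [].
  by apply: rk_lt; rewrite lt_neqAle n1 G_shift_le.
have h2 := sum_cube_shift L D (fun k => rk (G k)).
have h3 := sum_cube_widen (fun k => N - rk (G k)) (leq_addl D L).
have h4 M : \sum_(k : {ffun 'I_d -> 'I_M}) (N - rk (G (cube_point k))) +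
    \sum_(k : {ffun 'I_d -> 'I_M}) rk (G (cube_point k)) = N * M ^ d.
  by rewrite -big_split /= -cardQ; apply: eq_bigr => k _; rewrite subnK.
have := h4 L; have := h4 (D + L); rewrite mulnBr [L + D]addnC.
move: h1 h2 h3; rewrite /=; lia.
Qed.

(** Telescoping [double_changes_le] over the scales [2 ^ j * D0] with shrinking
cubes: the double changes, weighted by the inverse of the scale, have a sum
bounded by a quantity that is independent of the number [J] of scales, so that
one of the [J] terms is small. *)
Lemma few_double_changes (D0 J L : nat) : 0 < J ->
  exists2 j, j < J &
    J * num_double_changes (2 ^ j * D0) (L + 2 ^ J * D0 - 2 ^ j.+1 * D0) <=
    N * d * (L + 2 ^ J * D0) ^ d.-1 * (2 ^ j.+1 * D0).
Proof.
move=> J0; apply: contrapT => Hno.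
(* The cubes shrink so that the one of scale [j.+1], shifted by [D j], is
   contained in the one of scale [j]. *)
pose D j := 2 ^ j * D0; pose LL j := L + D J - D j.
pose M := N * d * (L + D J) ^ d.-1.
have DS j : D j.+1 = D j + D j by rewrite /D expnS -mulnA mul2n addnn.
have DJ j : j <= J -> D j <= D J.
  by move=> jJ; rewrite leq_mul2r leq_exp2l // jJ orbT.
have big j : j < J -> M * D j.+1 < J * num_double_changes (D j) (LL j.+1).
  by move=> jJ; rewrite ltnNge; apply/negP => h; apply: Hno; exists j.
have step j : j < J ->
    num_double_changes (D j) (LL j.+1) + num_changes (D j.+1) (LL j.+1) <=
    2 * num_changes (D j) (LL j).
  move=> jJ; rewrite DS; apply: leq_trans (double_changes_le _ _) _.
  rewrite leq_mul2l /=; apply: eq_leq; congr num_changes.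
  by rewrite /LL; have := DJ _ jJ; rewrite DS; lia.
have tele j : j < J -> J * num_changes (D j.+1) (LL j.+1) + j.+1 * (M * D j.+1)
    < 2 ^ j.+1 * (J * num_changes (D 0) (LL 0)).
  elim: j => [|j IH] jJ.
    have := big _ jJ; have : J * (num_double_changes (D 0) (LL 1) +
        num_changes (D 1) (LL 1)) <= J * (2 * num_changes (D 0) (LL 0)).
      by rewrite leq_mul2l step // orbT.
    lia.
  have := IH (ltnW jJ); have := big _ jJ.
  have : J * (num_double_changes (D j.+1) (LL j.+2) +
        num_changes (D j.+2) (LL j.+2)) <= J * (2 * num_changes (D j.+1) (LL j.+1)).
    by rewrite leq_mul2l step // orbT.
  rewrite [D j.+2]DS [2 ^ j.+2]expnS; lia.
have := tele J.-1; rewrite prednK // => /(_ (leqnn _)).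
have A0 : num_changes (D 0) (LL 0) <= M * D 0.
  apply: leq_trans (num_changes_le _ _) _.
  have -> : D 0 + LL 0 = L + D J by rewrite /LL; have := DJ 0 (leq0n _); lia.
  by apply: eq_leq; rewrite /M; ring.
apply/negP; rewrite -leqNgt.
have : 2 ^ J * (J * num_changes (D 0) (LL 0)) <= 2 ^ J * (J * (M * D 0)).
  by rewrite !leq_mul2l A0 !orbT.
move=> h; apply: leq_trans h _; rewrite /D expn0 mul1n.
by apply: leq_trans (leq_addl _ _); apply: eq_leq; ring.
Qed.

End MonotoneColouring.

(** * Moving the grid points along a linear map *)

Section GridSums.
Variables (R : realType) (d n : nat).
Implicit Types k : {ffun 'I_d -> 'I_(n + n).+1}.

Definition grid_point k : 'rV[R]_d := \row_i (((k i)%:R - n%:R) / n%:R).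

Definition in_ball k := dotr (grid_point k) (grid_point k) < 1.

Definition grid_flip (j : 'I_d) k : {ffun 'I_d -> 'I_(n + n).+1} :=
  [ffun i => if i == j then rev_ord (k i) else k i].

Definition grid_swap (j j' : 'I_d) k : {ffun 'I_d -> 'I_(n + n).+1} :=
  [ffun i => k (tperm j j' i)].

Lemma grid_flipK j : involutive (grid_flip j).
Proof.
by move=> k; apply/ffunP => i; rewrite !ffunE; case: eqP => // _; rewrite rev_ordK.
Qed.

Lemma grid_swapK j j' : involutive (grid_swap j j').
Proof. by move=> k; apply/ffunP => i; rewrite !ffunE tpermK. Qed.

Lemma grid_point_flip j k i :
  grid_point (grid_flip j k) 0 i =
  if i == j then - grid_point k 0 i else grid_point k 0 i.
Proof.
rewrite !mxE ffunE; case: eqP => // _; rewrite -mulNr; congr (_ / _).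
have kn := ltn_ord (k i).
rewrite opprB /= subSS natrB; last by rewrite -ltnS.
by rewrite natrD; lra.
Qed.

Lemma grid_point_swap j j' k i :
  grid_point (grid_swap j j' k) 0 i = grid_point k 0 (tperm j j' i).
Proof. by rewrite !mxE ffunE. Qed.

Lemma in_ball_flip j k : in_ball (grid_flip j k) = in_ball k.
Proof.
rewrite /in_ball /dotr; congr (_ < 1); apply: eq_bigr => i _.
by rewrite grid_point_flip; case: eqP => // _; rewrite mulrNN.
Qed.

Lemma in_ball_swap j j' k : in_ball (grid_swap j j' k) = in_ball k.
Proof.
rewrite /in_ball /dotr; congr (_ < 1).
rewrite [RHS](reindex_inj (@perm_inj _ (tperm j j'))) /=.
by apply: eq_bigr => i _; rewrite grid_point_swap.
Qed.

Lemma sum_ball_cross i j : i != j ->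
  \sum_(k | in_ball k) grid_point k 0 i * grid_point k 0 j = 0.
Proof.
move=> ij; apply/eqP; rewrite -eqNr; apply/eqP.
rewrite [in RHS](reindex_inj (inv_inj (grid_flipK i))) -sumrN /=.
apply: eq_big => k; first by rewrite in_ball_flip.
by move=> _; rewrite !grid_point_flip eqxx eq_sym (negPf ij) mulNr.
Qed.

Lemma sum_ball_square i j :
  \sum_(k | in_ball k) grid_point k 0 i * grid_point k 0 i =
  \sum_(k | in_ball k) grid_point k 0 j * grid_point k 0 j.
Proof.
rewrite (reindex_inj (inv_inj (grid_swapK i j))) /=.
apply: eq_big => k; first by rewrite in_ball_swap.
by move=> _; rewrite !grid_point_swap tpermL.
Qed.

(** The ball is invariant under sign changes and permutations of the
coordinates, so its second moments form a scalar matrix. *)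
Lemma sum_ball_quadratic (T : 'M[R]_d) :
  d%:R * \sum_(k | in_ball k) dotr (grid_point k) (grid_point k *m T) =
  \tr T * \sum_(k | in_ball k) dotr (grid_point k) (grid_point k).
Proof.
have E1 : \sum_(k | in_ball k) dotr (grid_point k) (grid_point k *m T) =
    \sum_i T i i * \sum_(k | in_ball k) grid_point k 0 i * grid_point k 0 i.
  transitivity (\sum_i \sum_j T i j *
      \sum_(k | in_ball k) grid_point k 0 i * grid_point k 0 j); last first.
    apply: eq_bigr => i _; rewrite [LHS](bigD1 i) //= [X in _ + X]big1 ?addr0 // => j ji.
    by rewrite sum_ball_cross 1?eq_sym // mulr0.
  under [RHS]eq_bigr => i _ do under eq_bigr => j _ do rewrite mulr_sumr.
  under [RHS]eq_bigr => i _ do rewrite exchange_big /=.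
  rewrite [RHS]exchange_big; apply: eq_bigr => k _.
  rewrite /dotr [RHS]exchange_big; apply: eq_bigr => j _.
  rewrite [(_ *m _) 0 j]mxE mulr_sumr; apply: eq_bigr => i _; ring.
have E2 : \sum_(k | in_ball k) dotr (grid_point k) (grid_point k) =
    \sum_i \sum_(k | in_ball k) grid_point k 0 i * grid_point k 0 i.
  by rewrite exchange_big.
rewrite E1 E2 mulr_sumr mulr_suml; apply: eq_bigr => i _.
rewrite mulrCA; congr (_ * _).
rewrite -(eq_bigr _ (fun j _ => sum_ball_square i j)) sumr_const card_ord.
by rewrite mulr_natl.
Qed.

End GridSums.

(** The grid points with all coordinates between [1 / (4 d)] and [1 / (2 d)] are
in the ball and already contribute this much. *)
Lemma sum_ball_lower (R : realType) (d a n : nat) :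
  (0 < d)%N -> (0 < a)%N -> n = (4 * d * a)%N ->
  (a ^ d)%:R / (16 * d%:R) <=
  \sum_(k | in_ball R (n := n) k) dotr (grid_point R k) (grid_point R (d := d) k).
Proof.
move=> d0 a0 nE.
have hn k : (k < a)%N -> (k + n + a < (n + n).+1)%N.
  have : (1 * a <= d * a)%N by rewrite leq_mul2r d0 orbT.
  by rewrite nE; lia.
pose f (k : {ffun 'I_d -> 'I_a}) : {ffun 'I_d -> 'I_(n + n).+1} :=
  [ffun i => Ordinal (hn _ (ltn_ord (k i)))].
have injf : injective f.
  move=> k l /ffunP kl; apply/ffunP => i; apply/val_inj.
  by have /(congr1 val) := kl i; rewrite !ffunE /=; lia.
have dR : 0 < d%:R :> R by rewrite ltr0n.
have aR : 0 < a%:R :> R by rewrite ltr0n.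
have coordf k i : ((4 * d%:R)^-1 <= grid_point R (f k) 0 i <= (2 * d%:R)^-1).
  rewrite !mxE ffunE /= !natrD nE !natrM.
  have ka : (k i)%:R <= a%:R :> R by rewrite ler_nat ltnW.
  have k0 : 0 <= (k i)%:R :> R by [].
  apply/andP; split.
    rewrite ler_pdivlMr ?mulr_gt0 // mulrA mulVf ?mul1r; last first.
      by rewrite mulf_neq0 ?gt_eqF.
    lra.
  rewrite ler_pdivrMr ?mulr_gt0 //.
  have -> : (2 * d%:R)^-1 * (4 * d%:R * a%:R) = 2 * a%:R :> R.
    by field; rewrite gt_eqF.
  lra.
have sqf k i : (16 * d%:R ^+ 2)^-1 <= grid_point R (f k) 0 i * grid_point R (f k) 0 i
    <= (4 * d%:R ^+ 2)^-1.
  have /andP[h1 h2] := coordf k i; rewrite -expr2.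
  have c0 : 0 < (4 * d%:R)^-1 :> R by rewrite invr_gt0 mulr_gt0.
  have -> : (16 * d%:R ^+ 2)^-1 = ((4 * d%:R)^-1) ^+ 2 :> R.
    by field; rewrite gt_eqF.
  have -> : (4 * d%:R ^+ 2)^-1 = ((2 * d%:R)^-1) ^+ 2 :> R.
    by field; rewrite gt_eqF.
  by rewrite !lerXn2r ?nnegrE //; lra.
have ballf k : in_ball R (f k).
  rewrite /in_ball /dotr; apply: le_lt_trans (_ : \sum_(i < d) (4 * d%:R ^+ 2)^-1 < 1).
    by apply: ler_sum => i _; case/andP: (sqf k i).
  rewrite sumr_const card_ord -[X in X < 1]mulr_natr.
  have -> : (4 * d%:R ^+ 2)^-1 * d%:R = (4 * d%:R)^-1 :> R.
    by field; rewrite gt_eqF.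
  have : 1 <= d%:R :> R by rewrite ler1n.
  by rewrite invf_lt1 ?mulr_gt0 //; lra.
pose sq k := dotr (grid_point R k) (grid_point R (d := d) (n := n) k).
apply: le_trans (_ : \sum_(k : {ffun 'I_d -> 'I_a}) sq (f k) <= _).
  apply: le_trans (_ : \sum_(k : {ffun 'I_d -> 'I_a}) (16 * d%:R)^-1 <= _).
    by rewrite sumr_const card_ffun !card_ord -[leRHS]mulr_natl.
  apply: ler_sum => k _.
  apply: le_trans (_ : \sum_(i < d) (16 * d%:R ^+ 2)^-1 <= _).
    rewrite sumr_const card_ord -[X in _ <= X]mulr_natr.
    suff -> : (16 * d%:R)^-1 = (16 * d%:R ^+ 2)^-1 * d%:R :> R by [].
    by field; rewrite gt_eqF.
  by apply: ler_sum => i _; case/andP: (sqf k i).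
rewrite -(big_imset sq (A := {ffun 'I_d -> 'I_a})) /=; last first.
  by move=> x y _ _ /injf.
rewrite [leRHS](bigID (mem (f @: {ffun 'I_d -> 'I_a}))) /=.
rewrite [X in X + _](eq_bigl (mem (f @: {ffun 'I_d -> 'I_a}))); last first.
  move=> k /=; apply: andb_idl => /imsetP[l _ ->]; exact: ballf.
by rewrite lerDl; apply: sumr_ge0 => k _; exact: dotrr_ge0.
Qed.

(** The grid has mesh [h = 1 / n], and [D] is the number of grid steps that bounds
the displacements. The displacement of [x] is [s T (v (G x))] rounded down to
the grid, with [s = D h / (8 t)] and [t] the norm of [T]. *)
Section PerturbedGrid.
Variables (R : realType) (d n D : nat) (K : set 'rV[R]_d) (T : 'M[R]_d).
Variables (disp : Order.disp_t) (W : porderType disp).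
Implicit Types x y : 'rV[R]_d.
Variables (G : 'rV[R]_d -> W) (v : W -> 'rV[R]_d) (eps c0 : R).

Definition unit_box (x : 'rV[R]_d) := forall i, `|x 0 i| <= 1.

Local Notation t := (mx_l1norm T).
Local Notation h := (n%:R^-1 : R).
Local Notation a := (D%:R / (8 * t)).

Hypotheses (n_gt0 : (0 < n)%N) (D_ge4 : (4 <= D)%N) (t_gt0 : 0 < t).
Hypothesis K_orthant : forall x, (forall i, 0 <= x 0 i) -> K x.
Hypothesis K_add : forall x y, K x -> K y -> K (x + y).
Hypothesis K_scale : forall r x, 0 <= r -> K x -> K (r *: x).
Hypothesis G_mono : forall x y, K (y - x) -> (G x <= G y)%O.
Hypotheses (eps_ge0 : 0 <= eps) (eps_le1 : eps <= 1).
Hypothesis v_close : forall x, unit_box x -> forall i, `|v (G x) 0 i - x 0 i| <= eps.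
Hypothesis T_pos : forall x y, unit_box x -> unit_box y -> (G x < G y)%O ->
  K ((v (G y) - v (G x)) *m T - const_mx c0).
Hypothesis D_c0 : 8 * t <= D%:R * c0.

Definition drift (w : 'rV[R]_d) : 'rV[R]_d :=
  \row_i ((Num.floor (a * (w *m T) 0 i))%:~R * h).

Definition moved (x : 'rV[R]_d) := x + drift (v (G x)).

(** The points whose level set is thin in the diagonal direction. *)
Definition isolated (x : 'rV[R]_d) :=
  (G (x - const_mx (D%:R * h)) != G x) && (G x != G (x + const_mx (D%:R * h))).

Let h_gt0 : 0 < h. Proof. by rewrite invr_gt0 ltr0n. Qed.
Let a_gt0 : 0 < a.
Proof. by rewrite divr_gt0 ?mulr_gt0 // ltr0n; apply: leq_trans D_ge4. Qed.
Let at_eq : a * t = D%:R / 8.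
Proof. by field; rewrite gt_eqF. Qed.
Let D4R : 4 <= D%:R :> R. Proof. by rewrite (ler_nat R 4 D). Qed.

Let value_le2 x i : unit_box x -> `|v (G x) 0 i| <= 2.
Proof.
move=> x1; have := v_close x1 i; have := x1 i; rewrite !ler_norml.
move: (v _ 0 i) (x 0 i) eps_le1 => p q e1.
by move=> /andP[? ?] /andP[? ?]; apply/andP; split; lra.
Qed.

Let driftE w i : exists2 r, 0 <= r < 1 &
  drift w 0 i = h * (a * (w *m T) 0 i - r).
Proof.
have -> : drift w 0 i = (Num.floor (a * (w *m T) 0 i))%:~R * h by rewrite [LHS]mxE.
set y := a * _.
have := floor_itv y; rewrite intrD -[1%:~R]/(1 : R); move: (_%:~R) => z.
move: y => y /andP[? ?]; exists (y - z); last by ring.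
by apply/andP; split; lra.
Qed.

Let norm_drift_le x i : unit_box x -> `|drift (v (G x)) 0 i| <= h * (D%:R / 4 + 1).
Proof.
move=> x1; have [r /andP[r0 r1] ->] := driftE (v (G x)) i.
rewrite normrM gtr0_norm // ler_wpM2l // ?(ltW h_gt0) //.
have : `|a * (v (G x) *m T) 0 i| <= D%:R / 4.
  rewrite normrM gtr0_norm //.
  have -> : D%:R / 4 = a * (t * 2) by rewrite mulrA at_eq; field.
  apply: ler_wpM2l; first exact: ltW.
  by apply: norm_mulmx_coord_le => j; apply: value_le2.
rewrite !ler_norml => /andP[? ?]; apply/andP; split; lra.
Qed.

(** A collision means [x - y = s T (v (G y) - v (G x))] up to a rounding error
of [h] in each coordinate, which is absorbed by the margin [s * c0 >= h]. *)
Lemma moved_lt_absurd x y : unit_box x -> unit_box y -> moved x = moved y ->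
  ~~ (G x < G y)%O.
Proof.
move=> x1 y1 exy; apply/negP => Gxy.
suff : (G y <= G x)%O by rewrite lt_geF.
apply: G_mono.
have -> : x - y = drift (v (G y)) - drift (v (G x)).
  have xE : x = y + drift (v (G y)) - drift (v (G x)) by rewrite -[y + _]exy addrK.
  rewrite [X in X - y]xE.
  by rewrite [LHS]addrC -[_ + _ - _]addrA addKr.
set z := v (G y); set w := v (G x).
have -> : drift z - drift w = (h * a) *: ((z - w) *m T - const_mx c0) +
   (drift z - drift w - (h * a) *: ((z - w) *m T - const_mx c0)).
  by rewrite [RHS]addrC subrK.
apply: K_add.
  apply: K_scale; last exact: T_pos.
  by apply: mulr_ge0; exact: ltW.
apply: K_orthant => i.
have [r /andP[r0 r1] rE] := driftE z i; have [q /andP[q0 q1] qE] := driftE w i.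
rewrite mxE [in X in _ <= X + _]mxE [in X in _ <= _ + X + _]mxE rE qE.
rewrite mulmxBl.
set A := z *m T; set B := w *m T.
have -> : (- ((h * a) *: (A - B - const_mx c0))) 0 i =
  h * (a * c0) - h * (a * A 0 i) + h * (a * B 0 i) by rewrite !mxE; ring.
have -> : h * (a * A 0 i - r) + - (h * (a * B 0 i - q)) +
   (h * (a * c0) - h * (a * A 0 i) + h * (a * B 0 i)) = h * (a * c0 - r + q) by ring.
apply: mulr_ge0; first exact: ltW.
suff : 1 <= a * c0 by lra.
rewrite mulrAC ler_pdivlMr ?mulr_gt0 // mul1r.
exact: D_c0.
Qed.

(** The values at colliding points that are not isolated are comparable: [y] is
between [x - D h e] and [x + D h e], and [G] takes the value [G x] at one of
these ends. *)
Lemma moved_inj x y : unit_box x -> unit_box y -> ~~ isolated x ->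
  moved x = moved y -> x = y.
Proof.
move=> x1 y1 nbad exy.
have near i : `|y 0 i - x 0 i| <= D%:R * h.
  have -> : y 0 i - x 0 i = drift (v (G x)) 0 i - drift (v (G y)) 0 i.
    have := congr1 (fun z : 'rV_d => z 0 i) exy.
    by rewrite /moved mxE [RHS]mxE; lra.
  apply: le_trans (ler_normB _ _) _.
  have := norm_drift_le i x1; have := norm_drift_le i y1.
  have : h * (D%:R / 4 + 1) + h * (D%:R / 4 + 1) <= D%:R * h.
    rewrite -mulrDr [leRHS]mulrC ler_wpM2l ?(ltW h_gt0) //.
    by move: D4R; lra.
  by lra.
have lo : (G (x - const_mx (D%:R * h)) <= G y)%O.
  apply/G_mono/K_orthant => i; rewrite !mxE.
  by have := near i; rewrite ler_norml; move: (_ * h) => Dh /andP[]; lra.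
have hi : (G y <= G (x + const_mx (D%:R * h)))%O.
  apply/G_mono/K_orthant => i; rewrite !mxE.
  by have := near i; rewrite ler_norml; move: (_ * h) => Dh /andP[]; lra.
have : (G x <= G y)%O || (G y <= G x)%O.
  move: nbad; rewrite negb_and !negbK => /orP[/eqP <-|/eqP ->].
    by rewrite lo.
  by rewrite hi orbT.
have n1 := moved_lt_absurd x1 y1 exy.
have n2 := moved_lt_absurd y1 x1 (esym exy).
have eqG : (G x <= G y)%O || (G y <= G x)%O -> G x = G y.
  move=> /orP[]; rewrite le_eqVlt.
    by rewrite (negPf n1) orbF => /eqP.
  by rewrite (negPf n2) orbF => /eqP.
move=> /eqG e; move: exy; rewrite /moved e.
exact: addIr.
Qed.

(** Of this cut-off paraboloid only the lower bound [1 - dotr x x] is needed at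
the moved point, where a smooth bump would need a Taylor estimate. *)
Definition bump (x : 'rV[R]_d) : R := Num.max 0 (1 - dotr x x).

Lemma bump_ge0 x : 0 <= bump x.
Proof. by rewrite le_max lexx. Qed.

Lemma bump_le1 x : bump x <= 1.
Proof. by rewrite ge_max ler01 /=; have := dotrr_ge0 x; lra. Qed.

Let drift_error := 2 * h * a * (t * eps) + 2 * h * d%:R + d%:R * (D%:R * h) ^+ 2.

Lemma bump_moved_ge x : dotr x x < 1 ->
  bump x - 2 * h * a * dotr x (x *m T) - drift_error <= bump (moved x).
Proof.
move=> xball.
have x1 : unit_box x by move=> i; apply: norm_coord_le1; exact: ltW.
have -> : bump x = 1 - dotr x x by rewrite /bump max_r //; lra.
apply: le_trans (_ : 1 - dotr (moved x) (moved x) <= _); last first.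
  by rewrite le_max lexx orbT.
rewrite /moved; set w := drift _.
rewrite dotrDl !dotrDr [dotr w x]dotrC.
have wsq : dotr w w <= d%:R * (D%:R * h) ^+ 2.
  rewrite mulr_natl -[d in _ *+ d]card_ord -sumr_const; apply: ler_sum => i _.
  rewrite -expr2 -[leLHS]real_normK ?num_real // lerXn2r ?nnegrE //.
  apply: le_trans (norm_drift_le i x1) _.
  by rewrite mulrC ler_wpM2r ?(ltW h_gt0) //; move: D4R; lra.
have xw : dotr x w <= h * a * dotr x (x *m T) + h * a * (t * eps) + h * d%:R.
  have le1 : dotr x w <= h * a * dotr x (v (G x) *m T) + h * d%:R.
    have -> : d%:R = \sum_(i < d) (1 : R) by rewrite sumr_const card_ord.
    rewrite -mulrA -mulrDr [X in _ * (X + _)]mulr_sumr -big_split mulr_sumr.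
    apply: ler_sum => i _ /=.
    have [r /andP[r0 r1] ->] := driftE (v (G x)) i.
    have -> : x 0 i * (h * (a * (v (G x) *m T) 0 i - r)) =
       h * (a * (x 0 i * (v (G x) *m T) 0 i) - x 0 i * r) by ring.
    rewrite ler_wpM2l ?(ltW h_gt0) //.
    suff : - (x 0 i * r) <= 1 by lra.
    apply: le_trans (ler_norm _) _; rewrite normrN normrM -[leRHS]mulr1.
    by apply: ler_pM => //; rewrite ?ger0_norm // ltW.
  have le2 : dotr x (v (G x) *m T) <= dotr x (x *m T) + t * eps.
    rewrite -lerBlDl.
    have -> : dotr x (v (G x) *m T) - dotr x (x *m T) =
        dotr x ((v (G x) - x) *m T).
      by rewrite mulmxBl dotrDr -[X in _ = _ + dotr _ X]scaleN1r dotrZr mulN1r.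
    apply: le_trans (ler_norm _) _; apply: norm_dotr_mulmx_le => // i.
    by have := v_close x1 i; rewrite !mxE.
  apply: le_trans le1 _; rewrite lerD2r -mulrDr ler_wpM2l //.
  by apply: mulr_ge0; exact: ltW.
by rewrite /drift_error; lra.
Qed.

Local Notation grid := {ffun 'I_d -> 'I_(n + n).+1}.

Lemma moved_grid (k : grid) :
  dotr (moved (grid_point R k)) (moved (grid_point R k)) < 1 ->
  exists l : grid, grid_point R l = moved (grid_point R k).
Proof.
move=> ball; pose z i := Num.floor (a * (v (G (grid_point R k)) *m T) 0 i).
have zE i : moved (grid_point R k) 0 i = ((k i)%:R - n%:R + (z i)%:~R) * h.
  by rewrite /moved [LHS]mxE [X in X + _]mxE [X in _ + X]mxE -mulrDl.
have bnd i : (0 <= Posz (k i) + z i <= Posz (n + n)%N).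
  have := norm_coord_le1 i (ltW ball).
  rewrite zE ler_norml -(ler_int R) -(ler_int R _ (Posz _)) intrD -!pmulrn natrD.
  rewrite ler_pdivrMr ?ltr0n // ler_pdivlMr ?ltr0n //.
  move=> /andP[? ?]; apply/andP; split; lra.
exists [ffun i => inord `|(Posz (k i) + z i)%R|%N]; apply/rowP => i.
rewrite zE mxE ffunE inordK; last by have := bnd i; lia.
have /andP[b0 _] := bnd i.
congr (_ * _).
rewrite addrAC; congr (_ - _).
by rewrite natr_absz ger0_norm // intrD.
Qed.

(** Outside the isolated points the move is injective, so the moved points are
distinct grid points. *)
Lemma sum_bump_moved_le :
  \sum_(k : grid | in_ball R k) bump (moved (grid_point R k)) <=
  \sum_(k : grid | in_ball R k) bump (grid_point R k) +
  \sum_(k : grid | in_ball R k) (isolated (grid_point R k))%:R.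
Proof.
pose A := [set k : grid | [&& in_ball R k, ~~ isolated (grid_point R k) &
  dotr (moved (grid_point R k)) (moved (grid_point R k)) < 1]]%SET.
pose y (k : grid) :=
  odflt k [pick l | grid_point R l == moved (grid_point R k)].
have yE k : k \in A -> grid_point R (y k) = moved (grid_point R k).
  rewrite inE => /and3P[_ _ /moved_grid[l lE]]; rewrite /y.
  by case: pickP => [m /eqP //|/(_ l)]; rewrite lE eqxx.
have box k : in_ball R k -> unit_box (grid_point R k).
  by move=> kb i; apply: norm_coord_le1; exact: ltW.
have grid_inj : injective (@grid_point R d n).
  move=> k l /rowP kl; apply/ffunP => i; apply/val_inj.
  have := kl i; rewrite !mxE => /(mulIf (lt0r_neq0 h_gt0)) /addIr /eqP.
  by rewrite eqr_nat => /eqP.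
have yinj : {in A &, injective y}.
  move=> k l kA lA ykl; apply: grid_inj.
  have e : moved (grid_point R k) = moved (grid_point R l).
    by rewrite -!yE // ykl.
  move: kA lA; rewrite !inE => /and3P[kb nk _] /and3P[lb _ _].
  by apply: moved_inj => //; exact: box.
apply: le_trans (_ : \sum_(k in A) bump (moved (grid_point R k)) +
    \sum_(k : grid | in_ball R k) (isolated (grid_point R k))%:R <= _).
  rewrite [X in X + _]big_mkcond [X in _ + X]big_mkcond -big_split big_mkcond.
  apply: ler_sum => k _ /=; rewrite inE.
  case: ifP => kb /=; last by rewrite addr0.
  case: (isolated _) => /=; first by rewrite add0r bump_le1.
  case: ifP => [_|/negbT]; first by rewrite addr0.
  rewrite -leNgt addr0 => out.
  by rewrite /bump ge_max lexx /=; lra.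
rewrite lerD2r (eq_bigr (fun k => bump (grid_point R (y k)))); last first.
  by move=> k kA; rewrite yE.
rewrite -(big_imset (fun k => bump (grid_point R k)) yinj) /=.
rewrite [leLHS]big_mkcond [leRHS]big_mkcond; apply: ler_sum => k _ /=.
case: ifP => [|_]; last by case: ifP => // _; exact: bump_ge0.
move=> /imsetP[l lA ->]; suff -> : in_ball R (y l) by [].
by rewrite /in_ball yE //; move: lA; rewrite inE => /and3P[].
Qed.

(** The first-order effect of the move on the sum of [bump] is at most the number
of isolated points, up to the errors of second order, of rounding, and of the
approximation of the identity by [v (G x)]. *)
Lemma trace_le_isolated :
  - (2 * h * a) * \sum_(k : grid | in_ball R k)
     dotr (grid_point R k) (grid_point R k *m T) <=
  (\sum_(k : grid | in_ball R k) 1) * drift_error +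
  \sum_(k : grid | in_ball R k) (isolated (grid_point R k))%:R.
Proof.
have := sum_bump_moved_le.
have : \sum_(k : grid | in_ball R k) bump (grid_point R k)
   - (2 * h * a) * (\sum_(k : grid | in_ball R k)
     dotr (grid_point R k) (grid_point R k *m T)) -
   (\sum_(k : grid | in_ball R k) 1) * drift_error <=
   \sum_(k : grid | in_ball R k) bump (moved (grid_point R k)).
  rewrite mulr_sumr mulr_suml -!sumrB; apply: ler_sum => k kb.
  by rewrite mul1r; apply: bump_moved_ge.
lra.
Qed.

End PerturbedGrid.

(** * No finite monotone approximation when the trace is negative *)

(** The rank of a value is the number of smaller values. *)
Lemma finite_range_rank (X : Type) disp (W : porderType disp) (G : X -> W) :
  finite_set (range G) -> exists (rk : W -> nat) (N : nat),
    (forall x, rk (G x) <= N)%N /\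
    (forall x y, (G x < G y)%O -> (rk (G x) < rk (G y))%N).
Proof.
move=> /finite_seqP[s sE].
have inS x : G x \in s.
  by have : range G (G x) by [exists x]; rewrite sE.
exists (fun w => count (fun z => (z < w)%O) s), (size s).
split=> [x|x y xy]; first exact: count_size.
have mono z : (z < G x)%O -> (z < G y)%O by move=> /lt_trans; apply.
have := inS x; elim: s {sE inS} => //= z s IH; rewrite inE => /orP[/eqP <-|xs].
  by rewrite ltxx xy add0n add1n ltnS; apply: sub_count.
have := IH xs; have := mono z; case: (z < G x)%O => [->//|_].
by case: (z < G y)%O => //= H; rewrite add0n add1n ltnS ltnW.
Qed.

Lemma finite_uniform_bound (R : realType) (X : eqType) (l : seq X)
    (P : X -> R -> Prop) :
  (forall x c c', 0 < c' -> c' <= c -> P x c -> P x c') ->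
  (forall x, exists2 c, 0 < c & P x c) ->
  exists2 c, 0 < c & forall x, x \in l -> P x c.
Proof.
move=> Pdown Pex; elim: l => [|x l [c c0 IH]]; first by exists 1.
have [c' c'0 Px] := Pex x; exists (Num.min c c'); first by rewrite lt_min c0.
have m0 : 0 < Num.min c c' by rewrite lt_min c0.
move=> y; rewrite inE => /orP[/eqP ->|/IH Py].
  by apply: Pdown Px => //; rewrite ge_min lexx orbT.
by apply: Pdown Py => //; rewrite ge_min lexx.
Qed.

Section NoFiniteApproximation.
Variables (R : realType) (d : nat) (K : set 'rV[R]_d) (T : 'M[R]_d).
Implicit Types x y : 'rV[R]_d.

Hypothesis K_orthant : forall x, (forall i, 0 <= x 0 i) -> K x.
Hypothesis K_add : forall x y, K x -> K y -> K (x + y).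
Hypothesis K_scale : forall r x, 0 <= r -> K x -> K (r *: x).

(** Shifting the origin to the corner of a cube turns isolated points of the ball
into the midpoints of double changes. *)
Lemma isolated_le_double_changes n D E disp (W : porderType disp)
    (G : 'rV[R]_d -> W) : (0 < n)%N -> (D <= E)%N ->
  (\sum_(k : {ffun 'I_d -> 'I_(n + n).+1} | in_ball R k)
    isolated n D G (grid_point R k) <=
  num_double_changes (fun k : {ffun 'I_d -> nat} =>
     G (\row_i (((k i)%:R - n%:R - E%:R) / n%:R))) D
     ((n + n).+1 + E + E - (D + D)))%N.
Proof.
move=> n0 DE; set L := (_ - _)%N.
have hL i : (i < (n + n).+1)%N -> (i + (E - D) < L)%N by rewrite /L; lia.
pose f (k : {ffun 'I_d -> 'I_(n + n).+1}) : {ffun 'I_d -> 'I_L} :=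
  [ffun i => Ordinal (hL _ (ltn_ord (k i)))].
have injf : injective f.
  move=> k l /ffunP kl; apply/ffunP => i; apply/val_inj.
  by have /(congr1 val) := kl i; rewrite !ffunE /=; lia.
rewrite big_mkcond /=; apply: leq_trans (leq_sum_inj _ injf).
apply: leq_sum => k _; case: ifP => // _.
have n0R : n%:R != 0 :> R by rewrite pnatr_eq0 -lt0n.
rewrite /isolated /changes !diag_shiftD.
have E0 : \row_i (((cube_point (f k) i)%:R - n%:R - E%:R) / n%:R) =
    grid_point R k - const_mx (D%:R * n%:R^-1).
  by apply/rowP => i; rewrite !mxE !ffunE /= natrD natrB //; field.
have E1 : \row_i (((diag_shift D (cube_point (f k)) i)%:R - n%:R - E%:R) / n%:R)
    = grid_point R k.
  by apply/rowP => i; rewrite !mxE !ffunE /= !natrD natrB //; field.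
have E2 : \row_i (((diag_shift (D + D) (cube_point (f k)) i)%:R - n%:R - E%:R)
    / n%:R) = grid_point R k + const_mx (D%:R * n%:R^-1).
  by apply/rowP => i; rewrite !mxE !ffunE /= !natrD natrB //; field.
by rewrite E0 E1 E2.
Qed.

(** By [sum_ball_quadratic] and [sum_ball_lower] the left-hand side of
[trace_le_isolated] is at least a fixed multiple of [s] times the number of grid
points. The constants are chosen in the order [eps], [D0], [J], [m], each making one of
the four error terms at most [q / 5]. *)
Lemma trace_lt0_no_finite_approximation : (0 < d)%N -> \tr T < 0 ->
  exists2 eps : R, 0 < eps &
  forall disp (W : porderType disp) (G : 'rV[R]_d -> W) (v : W -> 'rV[R]_d),
    finite_set (range G) ->
    (forall x y, K (y - x) -> (G x <= G y)%O) ->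
    (forall x, unit_box x -> forall i, `|v (G x) 0 i - x 0 i| <= eps) ->
    (forall x y, unit_box x -> unit_box y -> (G x < G y)%O ->
      exists2 c : R, 0 < c & K ((v (G y) - v (G x)) *m T - const_mx c)) ->
    False.
Proof.
move=> d0 trT.
have dR : 0 < d%:R :> R by rewrite ltr0n.
set t := mx_l1norm T; set th := - \tr T.
have th0 : 0 < th by rewrite oppr_gt0.
have t0 : 0 < t.
  by apply: lt_le_trans (mxtrace_l1norm T); rewrite normr_gt0 lt_eqF.
pose q := th / (8 * d%:R ^+ 2).
have q0 : 0 < q by rewrite divr_gt0 // mulr_gt0 // exprn_gt0.
pose A : R := (12 * d%:R) ^+ d; pose B : R := (20 * d%:R) ^+ d.
have A0 : 0 < A by rewrite exprn_gt0 // mulr_gt0.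
have B0 : 0 < B by rewrite exprn_gt0 // mulr_gt0.
have epos : 0 < q / (10 * A * t) by rewrite divr_gt0 // !mulr_gt0.
exists (Num.min 1 (q / (10 * A * t))); first by rewrite lt_min ltr01.
set eps := Num.min _ _.
have eps1 : eps <= 1 by rewrite ge_min lexx.
have epsq : A * (2 * t * eps) <= q / 5.
  have : eps <= q / (10 * A * t) by rewrite ge_min lexx orbT.
  rewrite ler_pdivlMr ?mulr_gt0 //; lra.
have eps0 : 0 <= eps by rewrite le_min ler01 ltW.
move=> disp W G v Gfin Gmono vclose Tstrict.
have [rk [N [rkN rklt]]] := finite_range_rank Gfin.
have [c0 c0_gt0 Tpos] : exists2 c0 : R, 0 < c0 & forall x y, unit_box x ->
    unit_box y -> (G x < G y)%O -> K ((v (G y) - v (G x)) *m T - const_mx c0).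
  have /finite_seqP[s sE] := Gfin.
  have inS x : G x \in s.
  by have : range G (G x) by [exists x]; rewrite sE.
  pose P (p : W * W) (c : R) := forall x y, unit_box x -> unit_box y ->
    (G x < G y)%O -> p = (G x, G y) -> K ((v (G y) - v (G x)) *m T - const_mx c).
  have Pdown p c c' : 0 < c' -> c' <= c -> P p c -> P p c'.
    move=> _ cc' Pp x y x1 y1 xy pE; have := Pp x y x1 y1 xy pE.
    set z := _ *m T => Kz; have -> : z - const_mx c' =
      (z - const_mx c) + const_mx (c - c').
      by apply/rowP => i; rewrite !mxE; lra.
    by apply: K_add => //; apply: K_orthant => i; rewrite mxE subr_ge0.
  have Pex p : exists2 c, 0 < c & P p c.
    have [[x [y [x1 y1 xy pE]]]|no] := pselect (exists x y,
      [/\ unit_box x, unit_box y, (G x < G y)%O & p = (G x, G y)]).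
      have [c cpos Kc] := Tstrict x y x1 y1 xy; exists c => // x' y' _ _ _.
      by rewrite pE => -[<- <-].
    by exists 1 => // x y x1 y1 xy pE; case: no; exists x, y.
  have [c cpos Pc] := finite_uniform_bound
    [seq (w, w') | w <- s, w' <- s] Pdown Pex.
  exists c => // x y x1 y1 xy; apply: Pc xy _ => //.
  by apply/allpairsP; exists (G x, G y); split => /=.
have large (k : nat) (r : R) : exists2 N' : nat, (k < N')%N & r <= N'%:R.
  exists (k + Num.truncn r).+1; first by rewrite ltnS leq_addr.
  by apply: le_trans (ltW (truncnS_gt r)) _; rewrite ler_nat ltnS leq_addl.
have [D0 D04 [D0c D0q]] : exists2 D0 : nat, (4 < D0)%N &
    8 * t / c0 <= D0%:R /\ 80 * A * t * d%:R / q <= D0%:R.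
  have [N1 N14 N1c] := large 4%N (8 * t / c0).
  have [N2 N12 N2q] := large N1 (80 * A * t * d%:R / q).
  exists N2; first exact: ltn_trans N12.
  by split=> //; apply: le_trans N1c _; rewrite ler_nat ltnW.
have [J J0 hJ] := large 0%N (80 * t * N%:R * d%:R * B / q).
have [E EE] : exists E, E = (2 ^ J * D0)%N by exists (2 ^ J * D0)%N.
have [m Em hm] := large E (40 * A * t * d%:R * E%:R / q).
have m0 : (0 < m)%N by apply: leq_trans Em.
have [n nE] : exists n, n = (4 * d * m)%N by exists (4 * d * m)%N.
have n0 : (0 < n)%N by rewrite nE !muln_gt0 d0.
have mn : (m <= n)%N.
  by rewrite nE -[leqLHS]mul1n leq_mul2r muln_gt0 d0 orbT.
have En : (E < n)%N by apply: leq_trans mn.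
have n3 : ((n + n).+1 <= 3 * n)%N by clear -n0; lia.
have n5 : ((n + n).+1 + E + E <= 5 * n)%N by clear -En; lia.
pose G0 (k : {ffun 'I_d -> nat}) := G (\row_i (((k i)%:R - n%:R - E%:R) / n%:R)).
have G0mono (k l : {ffun 'I_d -> nat}) : (forall i, (k i <= l i)%N) ->
    (G0 k <= G0 l)%O.
  move=> kl; apply/Gmono/K_orthant => i; rewrite !mxE -mulrBl.
  apply: mulr_ge0; last by rewrite invr_ge0.
  by have := kl i; rewrite -(ler_nat R); lra.
have G0rk (k : {ffun 'I_d -> nat}) : (rk (G0 k) <= N)%N by exact: rkN.
have G0lt (k l : {ffun 'I_d -> nat}) : (G0 k < G0 l)%O ->
    (rk (G0 k) < rk (G0 l))%N by exact: rklt.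
have [j jJ few] :=
  few_double_changes G0mono G0rk G0lt D0 ((n + n).+1 + E) J0.
have [D DE'] : exists D, D = (2 ^ j * D0)%N by exists (2 ^ j * D0)%N.
have DD0 : (D0 <= D)%N by rewrite DE' -[leqLHS]mul1n leq_mul2r expn_gt0 orbT.
have D4 : (4 <= D)%N by apply: leq_trans DD0; exact: ltnW.
have DE : (D <= E)%N by rewrite DE' EE leq_mul2r leq_exp2l // ltnW ?orbT.
have DR : 0 < D%:R :> R by rewrite ltr0n; apply: leq_trans D4.
have Dc0 : 8 * t <= D%:R * c0.
  by rewrite -ler_pdivrMr //; apply: le_trans D0c _; rewrite ler_nat.
have := trace_le_isolated n0 D4 t0 K_orthant K_add K_scale Gmono eps0 eps1
  vclose Tpos Dc0.
rewrite -/t -[X in _ + X]natr_sum.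
have := isolated_le_double_changes G n0 DE.
set bad := (X in (X <= _)%N); set Q := \sum_(_ | _) dotr _ _.
set cnt := \sum_(_ | _) 1; set err := (X in cnt * X) => hbad.
have few' : J%:R * bad%:R <= N%:R * B * m%:R ^+ d / n%:R * (2 * D%:R) * d%:R :> R.
  have : (J * bad <= N * d * ((n + n).+1 + E + E) ^ d.-1 * (D + D))%N.
    have DS : (2 ^ j.+1 * D0 = D + D)%N.
      by rewrite expnS -mulnA -DE' mul2n addnn.
    move: few; rewrite DS -EE -DE'; apply: leq_trans.
    by rewrite leq_mul2l hbad orbT.
  rewrite -(ler_nat R) natrM => /le_trans; apply.
  have h5 : (((n + n).+1 + E + E)%N%:R : R) ^+ d.-1 <= (20 * d%:R * m%:R) ^+ d.-1.
    rewrite lerXn2r ?nnegrE // ?mulr_ge0 //.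
    have -> : 20 * d%:R * m%:R = (5 * n)%N%:R :> R.
      by rewrite nE !natrM; ring.
    by rewrite ler_nat.
  have h6 : (20 * d%:R * m%:R) ^+ d.-1 <= B * m%:R ^+ d / n%:R :> R.
    rewrite ler_pdivlMr ?ltr0n // /B -exprMn.
    have -> : (20 * d%:R * m%:R) ^+ d =
      (20 * d%:R * m%:R) ^+ d.-1 * (20 * d%:R * m%:R) :> R by rewrite -exprSr prednK.
    rewrite ler_wpM2l //.
    by rewrite nE !natrM ler_wpM2r // ler_wpM2r //; lra.
  rewrite !natrM natrX (natrD _ D D).
  have -> : N%:R * d%:R * ((n + n).+1 + E + E)%N%:R ^+ d.-1 * (D%:R + D%:R) =
    ((N%:R * (2 * D%:R)) * d%:R) * ((n + n).+1 + E + E)%N%:R ^+ d.-1 :> R by ring.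
  have -> : N%:R * B * m%:R ^+ d / n%:R * (2 * D%:R) * d%:R =
    ((N%:R * (2 * D%:R)) * d%:R) * (B * m%:R ^+ d / n%:R) :> R by ring.
  apply: ler_wpM2l; first by rewrite !mulr_ge0.
  exact: le_trans h6.
have cntA : cnt <= A * m%:R ^+ d.
  rewrite /cnt sumr_const.
  apply: le_trans (_ : (#|{ffun 'I_d -> 'I_(n + n).+1}|)%:R <= _).
    by rewrite ler_nat max_card.
  rewrite card_ffun !card_ord natrX /A -exprMn lerXn2r ?nnegrE // ?mulr_ge0 //.
  have -> : 12 * d%:R * m%:R = (3 * n)%N%:R :> R by rewrite nE !natrM; ring.
  by rewrite ler_nat.
have S2 := @sum_ball_lower R d m n d0 m0 nE.
have quad := @sum_ball_quadratic R d n T.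
move: S2 quad; rewrite -/Q; set S := \sum_(_ | _) _ => S2 quad.
have nR : 0 < n%:R :> R by rewrite ltr0n.
have mR : 0 < m%:R ^+ d :> R by rewrite exprn_gt0 // ltr0n.
have JR : 0 < J%:R :> R by rewrite ltr0n.
pose a : R := D%:R / (8 * t) / n%:R.
have a0 : 0 < a by rewrite !divr_gt0 // mulr_gt0.
have Qlow : 2 * a * (q * m%:R ^+ d / 2) <= - (2 * n%:R^-1 * (D%:R / (8 * t))) * Q.
  have -> : - (2 * n%:R^-1 * (D%:R / (8 * t))) * Q = 2 * a * (- Q).
    by rewrite /a; ring.
  apply: ler_wpM2l; first by rewrite mulr_ge0 // ltW.
  have -> : - Q = th * S / d%:R.
    by rewrite /th mulNr mulNr -quad mulrAC mulfV ?gt_eqF // mul1r.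
  rewrite ler_pdivlMr //; apply: le_trans (_ : th * (m%:R ^+ d / (16 * d%:R)) <= _).
    rewrite /q le_eqVlt; apply/orP; left; apply/eqP; field; rewrite gt_eqF //.
  by rewrite ler_wpM2l ?(ltW th0) // -natrX.
have errE : err = a * (2 * t * eps + 16 * t * d%:R / D%:R
    + 8 * t * d%:R * D%:R / n%:R).
  by rewrite /err /a; field; rewrite !gt_eqF.
have e2 : A * (16 * t * d%:R / D%:R) <= q / 5.
  rewrite mulrA ler_pdivrMr //.
  have : 80 * A * t * d%:R / q <= D%:R.
    by apply: le_trans D0q _; rewrite ler_nat.
  rewrite ler_pdivrMr //; lra.
have e3 : A * (8 * t * d%:R * D%:R / n%:R) <= q / 5.
  rewrite mulrA ler_pdivrMr //.
  have : 40 * A * t * d%:R * E%:R / q <= n%:R.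
    by apply: le_trans hm _; rewrite ler_nat.
  rewrite ler_pdivrMr //.
  have : A * t * d%:R * D%:R <= A * t * d%:R * E%:R.
    by rewrite ler_wpM2l ?ler_nat // !mulr_ge0 // ltW.
  lra.
have e4 : bad%:R <= a * (q / 5) * m%:R ^+ d.
  move: hJ; rewrite ler_pdivrMr // => hJ.
  rewrite -(ler_pM2l JR); apply: le_trans few' _.
  have -> : N%:R * B * m%:R ^+ d / n%:R * (2 * D%:R) * d%:R =
    (80 * t * N%:R * d%:R * B) * (a * m%:R ^+ d / 5).
    by rewrite /a; field; rewrite !gt_eqF.
  have -> : J%:R * (a * (q / 5) * m%:R ^+ d) = J%:R * q * (a * m%:R ^+ d / 5).
    by ring.
  apply: ler_wpM2r => //; apply: mulr_ge0; last by rewrite invr_ge0.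
  by apply: mulr_ge0; exact: ltW.
have errb : cnt * err <= a * (3 * q / 5) * m%:R ^+ d.
  apply: le_trans (_ : A * m%:R ^+ d * err <= _).
    apply: ler_wpM2r => //; rewrite errE mulr_ge0 ?(ltW a0) //.
    by rewrite !addr_ge0 // !mulr_ge0 // ?invr_ge0 // ltW.
  have -> : A * m%:R ^+ d * err = (a * m%:R ^+ d) * (A * (2 * t * eps) +
      A * (16 * t * d%:R / D%:R) + A * (8 * t * d%:R * D%:R / n%:R)).
    by rewrite errE; ring.
  have -> : a * (3 * q / 5) * m%:R ^+ d = (a * m%:R ^+ d) * (3 * q / 5) by ring.
  apply: ler_wpM2l; first by apply: mulr_ge0; exact: ltW.
  by apply: le_trans (lerD (lerD epsq e2) e3) _; move: (q) => r; lra.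
have aq : 0 < a * q * m%:R ^+ d by apply: mulr_gt0 => //; exact: mulr_gt0.
lra.
Qed.

End NoFiniteApproximation.

(** * Continuous dcpos *)

Section DomainFacts.
Local Open Scope order_scope.
Variables (disp : Order.disp_t) (D : porderType disp).
Implicit Types (A B : set D) (x y z : D).

Lemma way_below_le x y : way_below x y -> x <= y.
Proof.
move=> xy; have [|||a -> //] := xy [set y] y.
- by split; [exists y|move=> _ _ -> ->; exists y].
- by split=> [z ->//|z]; apply.
- by [].
Qed.

Lemma way_below_lel x x' y : x <= x' -> way_below x' y -> way_below x y.
Proof.
by move=> xx' x'y A s Ad As ys; have [a Aa x'a] := x'y A s Ad As ys; exists a => //;
  exact: le_trans x'a.
Qed.

Lemma way_below_ler x y y' : y <= y' -> way_below x y -> way_below x y'.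
Proof. by move=> yy' xy A s Ad As y's; apply: xy As _ => //; exact: le_trans y's. Qed.

(** Continuity only has to be checked on a directed set of approximants, since
it is cofinal among all of them. *)
Lemma domain_of_approximants :
  is_dcpo D ->
  (forall y, exists B, [/\ directed B, isLub B y & forall x, B x -> way_below x y]) ->
  is_domain D.
Proof.
move=> Ddcpo approx; split=> // y /=.
have [B [Bdir By Bway]] := approx y.
have cof x : way_below x y -> exists2 b, B b & x <= b.
  by move=> xy; exact: xy Bdir By (lexx y).
split; first split.
- by have [[b /Bway by_] _] := Bdir; exists b.
- move=> x x' /cof[b Bb xb] /cof[b' Bb' xb'].
  have [c [Bc bc b'c]] := Bdir.2 _ _ Bb Bb'.
  by exists c; split; [exact: Bway|exact: le_trans bc|exact: le_trans b'c].
split=> [x /cof[b Bb xb]|z zub]; first exact: le_trans (By.1 b Bb).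
by apply: By.2 => b /Bway; exact: zub.
Qed.

Lemma way_below_interpolate x y : is_domain D -> way_below x y ->
  exists2 z, way_below x z & way_below z y.
Proof.
move=> [Ddcpo Dcont] xy.
pose B := [set z | exists2 w, way_below z w & way_below w y].
have Bdir : directed B.
  split.
    have [[[w wy] _] _] := Dcont y; have [[[z zw] _] _] := Dcont w.
    by exists z, w.
  move=> z z' [w zw wy] [w' zw' w'y].
  have [[_ dirY] _] := Dcont y.
  have [v [vy wv w'v]] := dirY _ _ wy w'y.
  have [[_ dirV] _] := Dcont v.
  have [u [uv zu z'u]] := dirV _ _ (way_below_ler wv zw) (way_below_ler w'v zw').
  by exists u; split => //; exists v.
have Blub : isLub B y.
  split=> [z [w zw wy]|b bub].
    exact: le_trans (way_below_le zw) (way_below_le wy).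
  apply: (Dcont y).2.2 => w wy; apply: (Dcont w).2.2 => z zw.
  by apply: bub; exists w.
have [z [w zw wy] xz] := xy B y Bdir Blub (lexx y).
by exists w => //; exact: way_below_lel zw.
Qed.

End DomainFacts.

Section RBFacts.
Local Open Scope order_scope.

Lemma directed_image d d' (D : porderType d) (E : porderType d') (f : D -> E)
    (A : set D) :
  {homo f : x y / x <= y} -> directed A -> directed (f @` A).
Proof.
move=> fm [[a Aa] Adir]; split; first by exists (f a), a.
move=> _ _ [x Ax <-] [y Ay <-]; have [z [Az xz yz]] := Adir _ _ Ax Ay.
by exists (f z); split; [exists z|exact: fm|exact: fm].
Qed.

(** Transported along the retraction, the deflations of the bifinite domain keep a
finite range, stay below the identity and still approximate it. *)
Lemma RB_finite_approximations d (D : porderType d) : RB_domain D ->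
  exists F : set (D -> D), directed_approx_id F /\
    forall f, F f -> [/\ {homo f : x y / x <= y}, finite_set (range f) &
      forall x, f x <= x].
Proof.
move=> [_ [d' [E [[Edcpo [H [Hdir Hlub] HP]] [s [r [sc rc srK]]]]]]].
have rm := rc.1; have sm := sc.1.
pose tr (h : E -> E) (x : D) := r (h (s x)).
exists (tr @` H); split.
  split.
    apply: directed_image Hdir => h h' /lefP hh'; apply/lefP => x.
    exact/rm/hh'.
  move=> x; have [_ rlub] := rc.
  have dirx : directed [set h (s x) | h in H].
    by apply: directed_image Hdir => h h' /lefP; apply.
  have := rlub _ _ dirx (Hlub (s x)); rewrite srK.
  suff -> : r @` [set h (s x) | h in H] = [set f x | f in tr @` H] by [].
  apply/seteqP; split=> [_ [_ [h Hh <-] <-]|_ [_ [h Hh <-] <-]].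
    by exists (tr h) => //; exists h.
  by exists (h (s x)) => //; exists h.
move=> _ [h Hh <-]; have [[hc hfin hle] _] := HP h Hh; split.
- by move=> x y xy; apply/rm/hc.1/sm.
- apply: sub_finite_set (finite_image r hfin) => _ [x _ <-].
  by exists (h (s x)) => //; exists (s x).
- by move=> x; rewrite -[leRHS]srK; exact/rm/hle.
Qed.

(** The idempotent deflations are the intersections with finite sets. *)
Lemma powerset_bifinite (X : eqType) : bifinite_domain (set X).
Proof.
have bigcup_lub (A : set (set X)) : isLub A (\bigcup_(S in A) S).
  split=> [S AS|S Sub]; rewrite subsetEset; first by move=> x Sx; exists S.
  by move=> x [T AT Tx]; have := Sub T AT; rewrite subsetEset; apply.
split=> [A _|]; first by exists (\bigcup_(S in A) S).
exists [set f : set X -> set X | exists2 S, finite_set S & f = setI S].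
  split; first split.
  - by exists (setI set0), set0 => //; exact: finite_set0.
  - move=> _ _ [S Sfin ->] [T Tfin ->]; exists (setI (S `|` T)); split.
    + by exists (S `|` T) => //; rewrite finite_setU.
    + by apply/lefP => A; rewrite subsetEset => x [? ?]; split=> //; left.
    + by apply/lefP => A; rewrite subsetEset => x [? ?]; split=> //; right.
  move=> A; split=> [_ [_ [S _ ->] <-]|B Bub]; rewrite subsetEset; first by move=> x [].
  move=> x Ax; have := Bub ([set x] `&` A).
  rewrite subsetEset; apply; last by split.
  by exists (setI [set x]) => //; exists [set x] => //; exact: finite_set1.
move=> _ [S Sfin ->]; split; last by move=> A; rewrite /= setIA setIid.
split.
- split=> [A B|A s Adir As]; first by rewrite !subsetEset => AB; exact: setIS.
  have -> : s = \bigcup_(T in A) T.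
    by apply/le_anti/andP; split; [apply: As.2; exact: (bigcup_lub A).1|
      apply: (bigcup_lub A).2; exact: As.1].
  split=> [_ [T AT <-]|B Bub]; rewrite subsetEset => x [Sx].
    by move=> Tx; split=> //; exists T.
  case=> T AT Tx; have := Bub (S `&` T) (imageP _ AT).
  by rewrite subsetEset; apply.
- have /finite_seqP[s ->] := Sfin.
  pose sub (m : (size s).-tuple bool) := [set` mask m s].
  apply: (sub_finite_set (B := range sub)); last exact/finite_image/finite_finset.
  move=> _ [A _ <-]; exists (map_tuple (mem A) (in_tuple s)) => //.
  rewrite /sub /= -filter_mask; apply/seteqP; split=> x /=.
    by rewrite mem_filter => /andP[/set_mem].
  by case=> xs Ax; rewrite mem_filter xs andbT; exact/mem_set.
- by move=> A; rewrite subsetEset => x [].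
Qed.

(** The section [x |-> {y | y << x}] into the powerset is Scott-continuous by
interpolation. *)
Lemma complete_domain_RB d (D : porderType d) :
  is_domain D -> (forall A : set D, exists s, isLub A s) -> RB_domain D.
Proof.
move=> Ddom Dlub; have [Ddcpo Dcont] := Ddom; split => //.
have [sup supP] := choice Dlub.
exists set_display, (set D : porderType _); split; first exact: powerset_bifinite.
exists (fun x => [set y | way_below y x]), sup.
have lub_eq A s : isLub A s -> sup A = s.
  by move=> As; apply/le_anti/andP; split;
    [apply: (supP A).2; exact: As.1|apply: As.2; exact: (supP A).1].
split; last by move=> x; apply: lub_eq; exact: (Dcont x).2.
- split=> [x y xy|A s Adir As].
    by rewrite subsetEset => z; exact: way_below_ler.
  split=> [_ [x Ax <-]|B Bub]; rewrite subsetEset => z /=.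
    by apply: way_below_ler; exact: As.1.
  move=> /(way_below_interpolate Ddom)[w zw ws].
  have [a Aa wa] := ws A s Adir As (lexx s).
  have := Bub _ (imageP (fun x => [set y | way_below y x]) Aa).
  by rewrite subsetEset; apply; exact: way_below_ler zw.
split=> [A B|A S Adir AS].
  rewrite subsetEset => AB; apply: (supP A).2 => x Ax.
  by apply: (supP B).1; exact: AB.
split=> [_ [T AT <-]|b bub].
  apply: (supP T).2 => x Tx; apply: (supP S).1.
  by have := AS.1 T AT; rewrite subsetEset; apply.
apply: (supP S).2.
suff : (S <= [set x | (x <= b)%O] :> set D)%O by rewrite subsetEset.
apply: AS.2 => T AT; rewrite subsetEset => x Tx /=.
by apply: le_trans ((supP T).1 x Tx) _; apply: bub; exists T.
Qed.

End RBFacts.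

(** * The poset of nonpositive vectors with a bottom *)

Lemma grid_net (R : realType) (d : nat) (B eta : R) : 0 < eta ->
  exists M : seq 'rV[R]_d, forall x : 'rV[R]_d, (forall i, `|x 0 i| <= B) ->
    exists2 m, m \in M & forall i, m 0 i <= x 0 i <= m 0 i + eta.
Proof.
move=> eta0; pose N := (Num.truncn (2 * B / eta)).+1.
pose pnt (k : {ffun 'I_d -> 'I_N}) : 'rV[R]_d := \row_i (eta * (k i)%:R - B).
exists [seq pnt k | k : {ffun 'I_d -> 'I_N}] => x xB.
pose y i := (x 0 i + B) / eta.
have y0 i : 0 <= y i.
  rewrite /y ler_pdivlMr // mul0r; have := xB i; rewrite ler_norml => /andP[]; lra.
have yN i : (Num.truncn (y i) < N)%N.
  rewrite ltnS; apply: le_truncn; rewrite /y ler_pM2r ?invr_gt0 //.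
  by have := xB i; rewrite ler_norml => /andP[]; lra.
exists (pnt [ffun i => Ordinal (yN i)]); first by rewrite map_f // mem_enum.
move=> i; rewrite mxE ffunE /=.
have xE : x 0 i = eta * y i - B by rewrite /y mulrC divfK ?gt_eqF //; ring.
have lo : (Num.truncn (y i))%:R <= y i by rewrite truncn_le.
have hi : y i <= (Num.truncn (y i))%:R + 1.
  by rewrite natr1; exact/ltW/truncnS_gt.
rewrite xE; apply/andP; split.
  by rewrite lerD2r ler_wpM2l // ltW.
rewrite addrAC lerD2r -[X in _ <= _ + X]mulr1 -mulrDr.
by rewrite ler_wpM2l // ltW.
Qed.

Section ConeOrder.
Variables (R : realType) (d : nat) (K : set 'rV[R]_d).
Variables (disp : Order.disp_t) (D : porderType disp).
Variables (bot : D) (pt : 'rV[R]_d -> D) (co : D -> 'rV[R]_d).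
Implicit Types (u w s : 'rV[R]_d) (x y : D) (A : set D).

(** What is used of the cone domain: [pt u] is the element given by a nonpositive
vector [u], with unspecified value otherwise, and [co] is its inverse. *)
Record cone_order : Prop := ConeOrder {
  order_bot : forall x, (bot <= x)%O;
  order_cases : forall x, x = bot \/ exists2 u, K (- u) & x = pt u;
  order_le : forall u w, K (- u) -> K (- w) -> ((pt u <= pt w)%O <-> K (w - u));
  order_nbot : forall u, K (- u) -> ~ (pt u <= bot)%O;
  order_co : forall u, K (- u) -> co (pt u) = u }.

Hypotheses (hK : proper_cone K) (hD : cone_order).

Lemma proper_add_eq u w s : K u -> K w -> s = u + w -> K s.
Proof. by move=> Ku Kw ->; exact: proper_add. Qed.

Lemma proper_const (r : R) : 0 <= r -> K (const_mx r).
Proof. by move=> r0; apply: (proper_orthant hK) => i; rewrite mxE. Qed.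

Lemma proper_const_le u (r r' : R) : K (u + const_mx r) -> r <= r' ->
  K (u + const_mx r').
Proof.
move=> Ku rr'; have r0 : 0 <= r' - r by rewrite subr_ge0.
apply: (proper_add_eq Ku (proper_const r0)).
by apply/rowP => i; rewrite !mxE; ring.
Qed.

Lemma order_neq_bot x u : K (- u) -> (pt u <= x)%O ->
  exists w, [/\ K (- w), x = pt w & K (w - u)].
Proof.
move=> Ku ux; have [xE|[w Kw xE]] := order_cases hD x.
  by case: (order_nbot hD Ku); rewrite -xE.
by exists w; split=> //; apply/(order_le hD) => //; rewrite -xE.
Qed.

Definition points A : set 'rV[R]_d := [set u | K (- u) /\ A (pt u)].

Lemma lub_no_points A : points A = set0 -> isLub A bot.
Proof.
move=> A0; split=> [x Ax|x _]; last exact: order_bot.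
have [->//|[u Ku xE]] := order_cases hD x.
by have : points A u by [split=> //; rewrite -xE]; rewrite A0.
Qed.

Lemma points_directed A u w : directed A -> points A u -> points A w ->
  exists v, [/\ points A v, K (v - u) & K (v - w)].
Proof.
move=> [_ Adir] [Ku Au] [Kw Aw]; have [x [Ax ux wx]] := Adir _ _ Au Aw.
have [v [Kv xE vu]] := order_neq_bot Ku ux.
exists v; split => //; first by split=> //; rewrite -xE.
by apply/(order_le hD) => //; rewrite -xE.
Qed.

(** For a basis of functionals that are nonnegative on [K], the values on the
points of [A] are monotone and bounded by 0. Their suprema are the coordinates of
the limit. *)
Lemma directed_limit A : directed A -> points A !=set0 -> exists s,
  [/\ K (- s), isLub A (pt s) &
   forall r : R, 0 < r -> exists2 u, points A u & K (u - s + const_mx r)].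
Proof.
move=> Adir [u0 Au0].
have [M [Mfree Mdual]] := dual_independent hK (leqnn d).
have Munit : M^T \in unitmx by rewrite unitmx_tr -row_free_unit.
pose S i := [set dotr (row i M) u | u in points A].
have S0 i : S i !=set0 by exists (dotr (row i M) u0), u0.
have Sub i : has_ubound (S i).
  exists 0 => _ [u [Ku _] <-]; have := Mdual i _ Ku.
  by rewrite -scaleN1r dotrZr mulN1r oppr_ge0.
have Ssup i : has_sup (S i) by split; [exact: S0|exact: Sub].
pose s := \row_i sup (S i) *m invmx M^T.
have sM i : dotr (row i M) s = sup (S i).
  rewrite /s; have := congr1 (fun x : 'rV_d => x 0 i) (mulmxKV Munit (\row_i sup (S i))).
  rewrite [RHS]mxE => <-; rewrite [RHS]mxE dotrC.
  by apply: eq_bigr => j _; rewrite !mxE.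
have mono u w i : K (w - u) -> dotr (row i M) u <= dotr (row i M) w.
  move=> uw; have := Mdual i _ uw.
  by rewrite dotrDr -scaleN1r dotrZr mulN1r subr_ge0.
have close (eta : R) : 0 < eta -> exists2 u, points A u & forall w, points A w -> K (w - u) ->
    forall i, `|(w *m M^T) 0 i - sup (S i)| <= eta.
  move=> eta0.
  have wM w i : (w *m M^T) 0 i = dotr (row i M) w.
    by rewrite dotrC mxE; apply: eq_bigr => j _; rewrite !mxE.
  suff [u Au uS] : exists2 u, points A u & forall i, i \in enum 'I_d ->
      sup (S i) - eta <= dotr (row i M) u.
    exists u => // w Aw uw i; rewrite wM distrC ger0_norm; last first.
      by rewrite subr_ge0; apply: sup_upper_bound => //; exists w.
    have := uS i (mem_enum _ i); have := mono _ _ i uw; lra.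
  elim: (enum 'I_d) => [|i l [u Au uS]]; first by exists u0.
  have [_ [w Aw <-] wS] := sup_adherent eta0 (Ssup i).
  have [v [Av vu vw]] := points_directed Adir Au Aw.
  exists v => // j; rewrite inE => /orP[/eqP ->|/uS jS].
    by apply: le_trans (ltW wS) _; exact: mono.
  by apply: le_trans jS _; exact: mono.
have lim (r : R) : 0 < r -> exists2 u, points A u &
    forall w, points A w -> K (w - u) -> K (w - s + const_mx r) /\ K (s - w + const_mx r).
  move=> r0; pose t := mx_l1norm (invmx M^T).
  have t0 : 0 <= t by apply: sumr_ge0 => i _; apply: sumr_ge0.
  have eta0 : 0 < r / (t + 1) by rewrite divr_gt0 //; lra.
  have [u Au uclose] := close _ eta0; exists u => // w Aw uw.
  have ws i : `|(w - s) 0 i| <= r.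
    have -> : w - s = (w *m M^T - \row_i sup (S i)) *m invmx M^T.
      by rewrite mulmxBl mulmxK.
    apply: le_trans (norm_mulmx_coord_le _ _ (_ : forall j, _ <= r / (t + 1))) _.
      by move=> j; have := uclose w Aw uw j; rewrite !mxE.
    rewrite -/t mulrA ler_pdivrMr; last by lra.
    by rewrite mulrC ler_wpM2l //; lra.
  by split; apply: (proper_orthant hK) => i; have := ws i;
    rewrite !mxE ler_norml => /andP[]; lra.
have Ks : K (- s).
  apply: (proper_archimedean hK) => r r0; have [u Au] := lim r r0.
  have Kuu : K (u - u) by rewrite subrr; exact: proper0.
  move=> /(_ u Au Kuu)[us _]; apply: (proper_add_eq Au.1 us).
  by apply/rowP => i; rewrite !mxE; ring.
exists s; split=> //; last first.
  move=> r r0; have [u Au] := lim r r0.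
  have Kuu : K (u - u) by rewrite subrr; exact: proper0.
  by move=> /(_ u Au Kuu)[us _]; exists u.
split=> [x Ax|y yub].
  have [->|[u Ku xE]] := order_cases hD x; first exact: order_bot.
  have Au : points A u by split=> //; rewrite -xE.
  rewrite xE; apply/(order_le hD) => //.
  apply: (proper_archimedean hK) => r r0; have [w Aw wlim] := lim r r0.
  have [v [Av vu vw]] := points_directed Adir Au Aw.
  have [_ sv] := wlim v Av vw; apply: (proper_add_eq vu sv).
  by apply/rowP => i; rewrite !mxE; ring.
have [w [Kw yE _]] := order_neq_bot Au0.1 (yub _ Au0.2).
rewrite yE; apply/(order_le hD) => //.
apply: (proper_archimedean hK) => r r0; have [u Au] := lim r r0.
have Kuu : K (u - u) by rewrite subrr; exact: proper0.
move=> /(_ u Au Kuu)[us _].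
have wu : K (w - u) by apply/(order_le hD Au.1 Kw); rewrite -yE; apply: yub; case: Au.
apply: (proper_add_eq wu us).
by apply/rowP => i; rewrite !mxE; ring.
Qed.

Lemma isLub_unique A x y : isLub A x -> isLub A y -> x = y.
Proof.
move=> Ax Ay; apply/le_anti/andP; split; first by apply: Ax.2; exact: Ay.1.
by apply: Ay.2; exact: Ax.1.
Qed.

Lemma cone_order_dcpo : is_dcpo D.
Proof.
move=> A Adir; have [A0|/set0P A0] := eqVneq (points A) set0.
  by exists bot; exact: lub_no_points.
by have [s [_ slub _]] := directed_limit Adir A0; exists (pt s).
Qed.

Lemma directed_lub_approx A s (r : R) : directed A -> K (- s) ->
  isLub A (pt s) -> 0 < r ->
  exists2 u, points A u & K (u - s + const_mx r).
Proof.
move=> Adir Ks Alub r0.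
have [A0|/set0P A0] := eqVneq (points A) set0.
  have := lub_no_points A0; move/(isLub_unique Alub) => sbot.
  by case: (order_nbot hD Ks); rewrite sbot.
have [s' [Ks' s'lub approx]] := directed_limit Adir A0.
have ss' : s = s'.
  by rewrite -(order_co hD Ks) (isLub_unique Alub s'lub) order_co.
by rewrite ss'; exact: approx.
Qed.

Lemma proper_shift u (r : R) : 0 <= r -> K (- u) -> K (- (u - const_mx r)).
Proof.
move=> r0 Ku; apply: (proper_add_eq Ku (proper_const r0)).
by rewrite opprB addrC.
Qed.

Lemma way_below_shift w (r : R) : 0 < r -> K (- w) ->
  way_below (pt (w - const_mx r)) (pt w).
Proof.
move=> r0 Kw A x Adir Alub wx.
have [s [Ks xE sw]] := order_neq_bot Kw wx; rewrite xE in Alub.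
have [u Au us] := directed_lub_approx Adir Ks Alub r0.
exists (pt u); first by case: Au.
apply/(order_le hD) => //; [exact: (proper_shift (ltW r0))|by case: Au|].
apply: (proper_add_eq us sw); apply/rowP => i; rewrite !mxE; ring.
Qed.

Lemma cone_order_domain : is_domain D.
Proof.
apply: domain_of_approximants => [|y]; first exact: cone_order_dcpo.
have [->|[w Kw ->]] := order_cases hD y.
  exists [set bot]; split.
  - by split; [exists bot|move=> _ _ -> ->; exists bot].
  - by split=> [x ->//|x]; apply.
  - by move=> _ -> A s [[a Aa] _] _ _; exists a => //; exact: order_bot.
exists [set pt (w - const_mx r) | r in [set r : R | 0 < r]]; split.
- split; first by exists (pt (w - const_mx 1)), 1 => //=.
  move=> _ _ [r /= r0 <-] [r' /= r'0 <-].
  pose m := Num.min r r'; have m0 : 0 < m by rewrite lt_min r0.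
  have shift_le q : 0 < q -> m <= q ->
      (pt (w - const_mx q) <= pt (w - const_mx m))%O.
    move=> q0 mq; apply/(order_le hD); [exact: (proper_shift (ltW q0))|
      exact: (proper_shift (ltW m0))|].
    have mq0 : 0 <= q - m by rewrite subr_ge0.
    by have := proper_const mq0; congr K; apply/rowP => i; rewrite !mxE; ring.
  exists (pt (w - const_mx m)); split; first by exists m.
    by apply: shift_le => //; rewrite ge_min lexx.
  by apply: shift_le => //; rewrite ge_min lexx orbT.
- split=> [_ [r /= r0 <-]|b bub].
    apply/(order_le hD) => //; first exact: (proper_shift (ltW r0)).
    have := proper_const (ltW r0); congr K.
    by apply/rowP => i; rewrite !mxE; ring.
  have Kw1 := proper_shift ler01 Kw.
  have b1 : (pt (w - const_mx 1) <= b)%O by apply: bub; exists 1 => /=.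
  have [v [Kv bE _]] := order_neq_bot Kw1 b1.
  rewrite bE; apply/(order_le hD) => //.
  apply: (proper_archimedean hK) => r r0.
  have : (pt (w - const_mx r) <= b)%O by apply: bub; exists r.
  rewrite bE; move=> /(order_le hD (proper_shift (ltW r0) Kw) Kv).
  by congr K; apply/rowP => i; rewrite !mxE; ring.
- by move=> _ [r /= r0 <-]; exact: way_below_shift.
Qed.

End ConeOrder.

Section ConeOrderFS.
Variables (R : realType) (d : nat) (K : set 'rV[R]_d).
Variables (disp : Order.disp_t) (D : porderType disp).
Variables (bot : D) (pt : 'rV[R]_d -> D) (co : D -> 'rV[R]_d).
Implicit Types (u w s : 'rV[R]_d) (x y : D) (A : set D).
Hypotheses (hK : proper_cone K) (hD : cone_order K bot pt co).

(** * Maps finitely separated from the identity *)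

(** The vectors [u] with [u + (n + 1) e] in the interior of the cone: a
Scott-open set, which the retreating maps need to be Scott-continuous. *)
Definition well_above (n : nat) u : Prop :=
  exists2 r : R, 0 < r & K (u + const_mx n.+1%:R - const_mx r).

Definition retreat (n : nat) (x : D) : D :=
  if `[< x <> bot /\ well_above n (co x) >] then pt (co x - const_mx n.+1%:R^-1)
  else bot.

Let inv_ge0 (n : nat) : 0 <= n.+1%:R^-1 :> R.
Proof. by rewrite invr_ge0. Qed.

Let pt_neq_bot u : K (- u) -> pt u <> bot.
Proof. by move=> Ku e; apply: (order_nbot hD Ku); rewrite e. Qed.

Lemma retreat_pt n u : K (- u) -> well_above n u ->
  retreat n (pt u) = pt (u - const_mx n.+1%:R^-1).
Proof.
move=> Ku un; rewrite /retreat (order_co hD Ku).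
by case: asboolP => // -[]; split=> //; exact: pt_neq_bot.
Qed.

Lemma retreat_cases n x : retreat n x = bot \/
  exists u, [/\ K (- u), well_above n u, x = pt u &
    retreat n x = pt (u - const_mx n.+1%:R^-1)].
Proof.
rewrite /retreat; case: asboolP => [[xb xn]|_]; last by left.
have [//|[u Ku xE]] := order_cases hD x.
right; exists u; have uE : co x = u by rewrite xE (order_co hD).
by rewrite uE in xn *.
Qed.

Lemma well_above_le n u w : well_above n u -> K (w - u) -> well_above n w.
Proof.
move=> [r r0 ur] uw; exists r => //; apply: (proper_add_eq hK ur uw).
by apply/rowP => i; rewrite !mxE; ring.
Qed.

Lemma retreat_homo n : {homo retreat n : x y / (x <= y)%O}.
Proof.
move=> x y xy; have [->|[u [Ku un xE ->]]] := retreat_cases n x.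
  exact: (order_bot hD).
have uy : (pt u <= y)%O by rewrite -xE.
have [w [Kw yE uw]] := order_neq_bot hD Ku uy.
rewrite yE retreat_pt //; last exact: well_above_le uw.
apply/(order_le hD); [exact: proper_shift|exact: proper_shift|].
by move: uw; congr K; apply/rowP => i; rewrite !mxE; ring.
Qed.

Lemma retreat_le n x : (retreat n x <= x)%O.
Proof.
have [->|[u [Ku un -> ->]]] := retreat_cases n x; first exact: (order_bot hD).
apply/(order_le hD) => //; first exact: proper_shift.
have := proper_const hK (inv_ge0 n); congr K.
by apply/rowP => i; rewrite !mxE; ring.
Qed.

Lemma retreat_scott n : scott_continuous (retreat n).
Proof.
split=> [|A x Adir Alub]; first exact: retreat_homo.
split=> [_ [a Aa <-]|y yub]; first by apply: retreat_homo; exact: Alub.1.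
have [->|[s [Ks [r r0 sr] xE ->]]] := retreat_cases n x; first exact: (order_bot hD).
rewrite xE in Alub.
have r20 : 0 < r / 2 by lra.
have [a Aa as_] := directed_lub_approx hK hD Adir Ks Alub r20.
have an : well_above n a.
  exists (r / 2) => //; apply: (proper_add_eq hK sr as_).
  by apply/rowP => i; rewrite !mxE; field.
have above u : points K pt A u -> K (u - a) ->
    (pt (u - const_mx n.+1%:R^-1) <= y)%O.
  move=> [Ku Au] au; rewrite -retreat_pt //; first by apply: yub; exists (pt u).
  exact: well_above_le an au.
have Kaa : K (a - a) by rewrite subrr; exact: proper0.
have [w [Kw yE _]] := order_neq_bot hD (proper_shift hK (inv_ge0 n) Aa.1)
  (above a Aa Kaa).
rewrite yE; apply/(order_le hD) => //; first exact: proper_shift.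
apply: (proper_archimedean hK) => e e0.
have [u Au us] := directed_lub_approx hK hD Adir Ks Alub e0.
have [v [Av vu va]] := points_directed hD Adir Au Aa.
have := above v Av va; rewrite yE => /(order_le hD (proper_shift hK (inv_ge0 n) Av.1) Kw) vw.
apply: (proper_add_eq hK vw); first apply: (proper_add_eq hK vu us).
  by reflexivity.
by apply/rowP => i; rewrite !mxE; ring.
Qed.

(** The vectors that are not sent to the bottom form a bounded set, and rounding
down to a grid of mesh [1 / (n + 1)] stays above [u - e / (n + 1)]. *)
Lemma retreat_separated n : finitely_separated (retreat n).
Proof.
have [B B0 Bbound] := order_interval_bounded hK.
have eta0 : 0 < n.+1%:R^-1 :> R by rewrite invr_gt0.
have [M Mnet] := @grid_net R d (B * n.+1%:R) _ eta0.
exists ([set bot] `|` pt @` [set` M]).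
  by rewrite finite_setU; split; [exact: finite_set1|exact/finite_image/finite_seq].
move=> x; have [->|[u [Ku [r r0 ur] -> ->]]] := retreat_cases n x.
  by exists bot; split; [left|exact: (order_bot hD)|exact: (order_bot hD)].
have un : K (u + const_mx n.+1%:R).
  apply: (proper_add_eq hK ur (proper_const hK (ltW r0))).
  by apply/rowP => i; rewrite !mxE; ring.
have ubound i : `|u 0 i| <= B * n.+1%:R.
  have n0 : 0 < n.+1%:R :> R by [].
  have -> : u 0 i = (n.+1%:R^-1 *: u) 0 i * n.+1%:R.
    by rewrite mxE mulrAC mulVf ?mul1r // gt_eqF.
  rewrite normrM [`|n.+1%:R|]ger0_norm // ler_wpM2r //.
  apply: Bbound.
    apply: (proper_add_eq hK (proper_const hK ler01) (proper_scale hK (inv_ge0 n) Ku)).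
    by rewrite scalerN.
  have := proper_scale hK (inv_ge0 n) un; congr K.
  by apply/rowP => j; rewrite !mxE mulrDr mulVf ?gt_eqF // addrC.
have [m mM mu] := Mnet u ubound.
have um : K (u - m).
  by apply: (proper_orthant hK) => i; rewrite !mxE; have /andP[] := mu i; lra.
have Km : K (- m).
  by apply: (proper_add_eq hK Ku um); apply/rowP => i; rewrite !mxE; ring.
exists (pt m); split; first by right; exists m.
  apply/(order_le hD) => //; first exact: proper_shift.
  apply: (proper_orthant hK) => i; rewrite !mxE; have := mu i.
  by move: (_^-1) (u 0 i) (m 0 i) => c p q /andP[]; lra.
exact/(order_le hD).
Qed.

Lemma well_above_ex u : exists n, well_above n u.
Proof.
have [b ub] : exists b : R, forall i, - u 0 i <= b.
  exists (\sum_i `|u 0 i|) => i; apply: le_trans (ler_norm _) _.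
  by rewrite normrN (bigD1 i) //= lerDl sumr_ge0.
exists (Num.truncn (b + 1)), 1 => //; apply: (proper_orthant hK) => i.
have := ub i; have := truncnS_gt (b + 1); rewrite !mxE; lra.
Qed.

Lemma well_above_mono n m u : (n <= m)%N -> well_above n u -> well_above m u.
Proof.
move=> nm [r r0 ur]; exists r => //.
have nm0 : 0 <= m.+1%:R - n.+1%:R :> R by rewrite subr_ge0 ler_nat.
apply: (proper_add_eq hK ur (proper_const hK nm0)).
by apply/rowP => i; rewrite !mxE; ring.
Qed.

Lemma retreat_mono n m x : (n <= m)%N -> (retreat n x <= retreat m x)%O.
Proof.
move=> nm; have [->|[u [Ku un -> _]]] := retreat_cases n x; first exact: (order_bot hD).
rewrite !retreat_pt //; last exact: well_above_mono un.
apply/(order_le hD); [exact: proper_shift|exact: proper_shift|].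
have nm0 : 0 <= n.+1%:R^-1 - m.+1%:R^-1 :> R.
  by rewrite subr_ge0 lef_pV2 ?posrE // ler_nat.
have := proper_const hK nm0; congr K.
by apply/rowP => i; rewrite !mxE; ring.
Qed.

Lemma cone_order_FS : FS_domain D.
Proof.
split; first exact: cone_order_domain hK hD.
exists (range retreat); last first.
  by move=> _ [n _ <-]; split; [exact: retreat_scott|exact: retreat_separated].
split; first split.
- by exists (retreat 0), 0%N.
- move=> _ _ [n _ <-] [m _ <-]; exists (retreat (maxn n m)); split.
  + by exists (maxn n m).
  + by apply/lefP => x; apply: retreat_mono; exact: leq_maxl.
  + by apply/lefP => x; apply: retreat_mono; exact: leq_maxr.
move=> x; split=> [_ [_ [n _ <-] <-]|y yub]; first exact: retreat_le.
have [->|[u Ku xE]] := order_cases hD x; first exact: (order_bot hD).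
have [n0 un0] := well_above_ex u.
have below n : (n0 <= n)%N -> (pt (u - const_mx n.+1%:R^-1) <= y)%O.
  move=> n0n; rewrite -retreat_pt //; last exact: well_above_mono un0.
  by rewrite -xE; apply: yub; exists (retreat n) => //; exists n.
have [w [Kw yE _]] := order_neq_bot hD (proper_shift hK (inv_ge0 n0) Ku)
  (below n0 (leqnn _)).
rewrite xE yE; apply/(order_le hD) => //; apply: (proper_archimedean hK) => e e0.
pose n := maxn n0 (Num.truncn e^-1).
have := below n (leq_maxl _ _); rewrite yE.
move=> /(order_le hD (proper_shift hK (inv_ge0 n) Ku) Kw) uw.
apply: (@proper_const_le _ _ _ hK _ n.+1%:R^-1).
  by move: uw; congr K; apply/rowP => i; rewrite !mxE; ring.
rewrite -[leRHS]invrK lef_pV2 ?posrE ?invr_gt0 //.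
apply: le_trans (ltW (truncnS_gt _)) _.
by rewrite ler_nat ltnS leq_maxr.
Qed.

(** * Finite-range approximations force a simplicial cone *)

(** On finitely many grid points [m] one of the maps is above [m - (eta / 2) e],
as this is way below [m]; monotonicity extends the estimate to all points. *)
Lemma RB_finite_map (eta : R) : RB_domain D -> 0 < eta ->
  exists f : D -> D, [/\ {homo f : x y / (x <= y)%O}, finite_set (range f) &
    forall u, (forall i, `|u 0 i| <= 3) -> K (- u) ->
      exists u', [/\ f (pt u) = pt u', K (- u'), K (u - u') &
        K (u' - u + const_mx eta)]].
Proof.
move=> RB eta0; have [F [[Fdir Flub] FP]] := RB_finite_approximations RB.
have eta20 : 0 < eta / 2 by lra.
have [M Mnet] := @grid_net R d 3 _ eta20.
have [f Ff fM] : exists2 f, F f & forall m, m \in M -> K (- m) ->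
    (pt (m - const_mx (eta / 2)) <= f (pt m))%O.
  elim: M {Mnet} => [|m M [f Ff fM]]; first by have [[f Ff] _] := Fdir; exists f.
  have [Km|nKm] := pselect (K (- m)); last first.
    by exists f => // m'; rewrite inE => /orP[/eqP ->|/fM].
  have dirm : directed [set g (pt m) | g in F].
    by apply: directed_image Fdir => g g' /lefP; apply.
  have [_ [g Fg <-] gm] := way_below_shift hK hD eta20 Km dirm (Flub _) (lexx _).
  have [h [Fh /lefP fh /lefP gh]] := Fdir.2 _ _ Ff Fg.
  exists h => // m'; rewrite inE => /orP[/eqP -> _|m'M Km'].
    exact: le_trans gm (gh _).
  exact: le_trans (fM _ m'M Km') (fh _).
have [fhomo ffin fle] := FP f Ff; exists f; split=> // u u3 Ku.
have [m mM mu] := Mnet u u3.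
have um : K (u - m).
  by apply: (proper_orthant hK) => i; rewrite !mxE; have /andP[] := mu i; lra.
have Km : K (- m).
  by apply: (proper_add_eq hK Ku um); apply/rowP => i; rewrite !mxE; ring.
have mfu : (pt (m - const_mx (eta / 2)) <= f (pt u))%O.
  apply: le_trans (fM m mM Km) _; apply: fhomo; exact/(order_le hD).
have [u' [Ku' fE mu']] := order_neq_bot hD (proper_shift hK (ltW eta20) Km) mfu.
exists u'; split=> //.
  by apply/(order_le hD Ku' Ku); rewrite -fE.
have mu2 : K (m + const_mx (eta / 2) - u).
  by apply: (proper_orthant hK) => i; rewrite !mxE; have /andP[] := mu i; lra.
by apply: (proper_add_eq hK mu' mu2); apply/rowP => i; rewrite !mxE; field.
Qed.

(** The unit box is centred at [- 2 e] to make all its points nonpositive, and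
the approximating map is extended beyond the nonpositive vectors by its largest
value. *)
Lemma RB_simplicial : (0 < d)%N -> RB_domain D ->
  exists2 B : 'M[R]_d, B \in unitmx &
    K = [set x | exists2 t : 'rV[R]_d, forall i, 0 <= t 0 i & x = t *m B].
Proof.
move=> d0 RB; have [//|[T trT Tpos]] := simplicial_or_strictly_positive hK.
exfalso; have [eps eps0 noapprox] := trace_lt0_no_finite_approximation
  (proper_orthant hK) (proper_add hK) (proper_scale hK) d0 trT.
have [B B0 Bbound] := order_interval_bounded hK.
have eta0 : 0 < eps / B by rewrite divr_gt0.
have [f [fhomo ffin fapprox]] := RB_finite_map RB eta0.
pose pt' u := if `[< K (- u) >] then pt u else pt 0.
have K0 : K (- 0) by rewrite oppr0; exact: proper0.
pose G u := f (pt' (u - const_mx 2)).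
have box u : unit_box u -> exists u', [/\ G u = pt u', K (- u'),
    K (u - const_mx 2 - u') & K (u' - (u - const_mx 2) + const_mx (eps / B))].
  move=> u1; have Ku : K (- (u - const_mx 2)).
    apply: (proper_orthant hK) => i; rewrite !mxE.
    by have := u1 i; rewrite ler_norml => /andP[]; lra.
  have := fapprox (u - const_mx 2); rewrite /G /pt'.
  case: asboolP => // _; apply => // i; rewrite !mxE.
  by have := u1 i; rewrite !ler_norml => /andP[? ?]; apply/andP; split; lra.
apply: (noapprox _ D G (fun x => co x + const_mx 2)).
- apply: sub_finite_set ffin => _ [u _ <-].
  by exists (pt' (u - const_mx 2)).
- move=> u w uw; apply: fhomo; rewrite /pt'.
  case: (asboolP (K (- (w - const_mx 2)))) => [Kw|_].
    have Ku : K (- (u - const_mx 2)).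
      by apply: (proper_add_eq hK Kw uw); apply/rowP => i; rewrite !mxE; ring.
    rewrite asboolT //; apply/(order_le hD) => //.
    by move: uw; congr K; apply/rowP => i; rewrite !mxE; ring.
  case: asboolP => [Ku|_]; last exact: lexx.
  by apply/(order_le hD) => //; rewrite sub0r.
- move=> u u1 i; have [u' [-> Ku' lo hi]] := box u u1; rewrite (order_co hD Ku').
  pose z := (B / eps) *: (u' - (u - const_mx 2)).
  have Be : 0 <= B / eps by rewrite ltW // divr_gt0.
  have zB : `|z 0 i| <= B.
    apply: Bbound.
      apply: (proper_add_eq hK (proper_const hK ler01) (proper_scale hK Be lo)).
      by rewrite -scalerN opprB.
    have := proper_scale hK Be hi; congr K.
    rewrite scalerDr addrC; congr (_ + _); apply/rowP => j; rewrite !mxE.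
    by field; rewrite !gt_eqF.
  have -> : (u' + const_mx 2) 0 i - u 0 i = eps / B * z 0 i.
    by rewrite !mxE; field; rewrite !gt_eqF.
  rewrite normrM ger0_norm ?(ltW eta0) // -[leRHS](divfK (lt0r_neq0 B0)).
  by rewrite ler_wpM2l // ltW.
move=> u w u1 w1; have [u' [-> Ku' _ _]] := box u u1; have [w' [-> Kw' _ _]] := box w w1.
rewrite lt_neqAle => /andP[neq /(order_le hD Ku' Kw') uw].
rewrite !(order_co hD) // opprD addrACA subrr addr0.
by apply: Tpos => //; apply: contra neq; rewrite subr_eq0 => /eqP ->.
Qed.

(** * The orthant *)

Lemma orthant_complete : K = [set u | forall i, 0 <= u 0 i] ->
  forall A, exists x, isLub A x.
Proof.
move=> KE A; have [A0|/set0P[u0 Au0]] := eqVneq (points K pt A) set0.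
  by exists bot; exact: (lub_no_points hD).
have Kle u w : K (w - u) <-> forall i, u 0 i <= w 0 i.
  rewrite KE; split=> h i; have := h i; rewrite !mxE subr_ge0; exact.
pose S i := [set u 0 i | u in points K pt A].
have Sub i u : points K pt A u -> u 0 i <= 0.
  by move=> [Ku _]; have := (Kle u 0).1; rewrite sub0r => /(_ Ku i); rewrite mxE.
have Ssup i : has_sup (S i).
  split; first by exists (u0 0 i), u0.
  by exists 0 => _ [u Au <-]; exact: Sub.
pose s := \row_i sup (S i).
have Ks : K (- s).
  rewrite -sub0r; apply/Kle => i; rewrite !mxE; apply: ge_sup.
    by exists (u0 0 i), u0.
  by move=> _ [u Au <-]; exact: Sub.
exists (pt s); split=> [x Ax|y yub].
  have [->|[u Ku xE]] := order_cases hD x; first exact: (order_bot hD).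
  have Au : points K pt A u by split=> //; rewrite -xE.
  rewrite xE; apply/(order_le hD) => //; apply/Kle => i; rewrite mxE.
  by apply: ub_le_sup; [exact: (Ssup i).2|exists u].
have [w [Kw yE _]] := order_neq_bot hD Au0.1 (yub _ Au0.2).
rewrite yE; apply/(order_le hD) => //; apply/Kle => i; rewrite mxE.
apply: ge_sup; first by exists (u0 0 i), u0.
move=> _ [u [Ku Au] <-]; have := yub _ Au; rewrite yE => /(order_le hD Ku Kw).
by move/Kle; apply.
Qed.

End ConeOrderFS.

(** * Coordinates adapted to the cone *)

Section ConeCoordinates.
Variables (R : realType) (V : vectType R) (C : set V) (hC : ccpg_cone C).
Local Notation d := (\dim {:V}).
Local Notation D := (cone_domain hC).
Import passmx.

Lemma cone0 : C 0.
Proof.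
by have [] : (C `&` [set - c | c in C]) 0 by rewrite (ccpg_cone_pointed hC).
Qed.

Lemma cone_add x y : C x -> C y -> C (x + y).
Proof.
move=> Cx Cy; have := @cone_le_trans _ _ _ hC 0 x (x + y).
by rewrite /cone_le !subr0 addrAC subrr add0r; apply.
Qed.

Lemma cone_sum (I : Type) (r : seq I) (F : I -> V) :
  (forall i, C (F i)) -> C (\sum_(i <- r) F i).
Proof.
by move=> CF; elim/big_ind: _ => //; [exact: cone0|exact: cone_add].
Qed.

(** A generating cone is contained in no proper subspace. *)
Lemma cone_free r : (r <= d)%N ->
  exists b : r.-tuple V, free b /\ forall i, C b`_i.
Proof.
elim: r => [_|r IH rd].
  exists [tuple]; rewrite nil_free; split=> // i.
  by rewrite nth_default //; exact: cone0.
have [b [bfree bC]] := IH (ltnW rd).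
have [c Cc cb] : exists2 c, C c & c \notin <<b>>%VS.
  apply: contrapT => no; move: rd; rewrite ltnNge => /negP; apply.
  apply: leq_trans (_ : \dim <<b>> <= r)%N.
    apply/dimvS/subvP => v _.
    have : [set: V] v by []. rewrite -(ccpg_cone_generating hC).
    move=> [x Cx [y Cy <-]]; apply: memvB; apply: contraT => xb; exfalso.
      by apply: no; exists x.
    by apply: no; exists y.
  by rewrite -[X in (_ <= X)%N](size_tuple b) dim_span.
exists (cons_tuple c b); split; first by rewrite free_cons cb.
by case=> [|i] //=.
Qed.

Lemma cone_basis : exists b : d.-tuple V, basis_of {:V} b /\ forall i, C b`_i.
Proof.
have [b [bfree bC]] := cone_free (leqnn d); exists b; split=> //.
by rewrite basisEfree bfree subvf size_tuple leqnn.
Qed.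

Section Coordinates.
Variable b : d.-tuple V.
Hypotheses (b_basis : basis_of {:V} b) (b_cone : forall i, C b`_i).

Definition coord_cone : set 'rV[R]_d := [set u | C (vecof b u)].

Local Notation K := coord_cone.

Lemma coord_cone_proper : proper_cone K.
Proof.
split.
- pose g (u : 'rV[R]_d) := rVof (vbasis {:V}) (vecof b u).
  have -> : K = g @^-1` [set rVof (vbasis {:V}) c | c in C].
    apply/seteqP; split=> u /=; first by move=> Ku; exists (vecof b u).
    by move=> [c Cc]; rewrite /g => /(can_inj (rVofK (vbasisP _))) cu;
      rewrite /coord_cone /= -cu.
  apply: preimage_closed (ccpg_cone_closed hC) => u _ A gA.
  have gi i : continuous (fun w => g w 0 i : R).
    have -> : (fun w => g w 0 i) =
        (fun w => dotr w (\row_j coord (vbasis {:V}) i b`_j)).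
      apply/funext => w; rewrite mxE linear_sum; apply: eq_bigr => j _.
      by rewrite linearZ mxE.
    apply: continuous_dotr => j; first exact: coord_continuous.
    exact: cst_continuous.
  have [P gP PA] := gA.
  have near i : nbhs u [set w | P 0 i (g w 0 i)] by exact: gi.
  change (nbhs u (g @^-1` A)).
  apply: filterS (filter_forall _ near) => w wP; apply: PA => i j.
  by rewrite ord1; exact: wP.
- by move=> u w Ku Kw; rewrite /K /= linearD; exact: cone_add.
- by move=> t u t0 Ku; rewrite /K /= linearZ; exact: (ccpg_cone_cone hC).
- move=> u u0; apply: cone_sum => i; exact: (ccpg_cone_cone hC).
- move=> u Ku KNu; apply: (can_inj (vecofK b_basis)); rewrite linear0.
  have : (C `&` [set - c | c in C]) (vecof b u).
    by split=> //; exists (vecof b (- u)) => //; rewrite linearN opprK.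
  by rewrite (ccpg_cone_pointed hC).
Qed.

Definition domain_point (u : 'rV[R]_d) : D :=
  if pselect ([set - c | c in C] (vecof b u)) is left h
  then Some (exist _ (vecof b u) (mem_set h)) else None.

Definition domain_coord (x : D) : 'rV[R]_d :=
  if x is Some a then rVof b (val a) else 0.

Let neg_mem u : K (- u) -> [set - c | c in C] (vecof b u).
Proof. by move=> Ku; exists (vecof b (- u)) => //; rewrite linearN opprK. Qed.

Let domain_pointE u : K (- u) ->
  exists h, domain_point u = Some (exist _ (vecof b u) h).
Proof.
move=> /neg_mem Ku; rewrite /domain_point; case: pselect => // h.
by exists (mem_set h).
Qed.

Lemma cone_domain_order : cone_order K (None : D) domain_point domain_coord.
Proof.
split.
- by [].
- case=> [[x xC]|]; last by left.
  right; have [c Cc cx] := set_mem xC; exists (rVof b x).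
    by rewrite /K /= linearN /= rVofK // -cx opprK.
  rewrite /domain_point; case: pselect => [h|]; last first.
    by rewrite rVofK //; case; exists c.
  by congr Some; apply/val_inj; exact: esym (rVofK b_basis x).
- move=> u w /domain_pointE[h ->] /domain_pointE[h' ->].
  rewrite /Order.le /= /K /= linearB /=.
  by split=> [/asboolP|] //; move=> ?; apply/asboolP.
- by move=> u /domain_pointE[h ->].
- by move=> u /domain_pointE[h ->]; rewrite /= vecofK.
Qed.

Lemma simplicial_coord : (exists2 B : 'M[R]_d, B \in unitmx &
    K = [set x | exists2 t : 'rV[R]_d, forall i, 0 <= t 0 i & x = t *m B]) ->
  simplicial C.
Proof.
move=> [B Bunit KE].
have vecofB t : vecof b (t *m B) = \sum_j t 0 j *: vecof b (row j B).
  by rewrite mulmx_sum_row linear_sum; apply: eq_bigr => j _; rewrite linearZ.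
exists [tuple vecof b (row j B) | j < d].
have nthE (j : 'I_d) : [tuple vecof b (row j B) | j < d]`_j = vecof b (row j B).
  by rewrite -tnth_nth tnth_mktuple.
split.
  rewrite basisEfree subvf size_tuple leqnn !andbT.
  apply/freeP => k k0 i; pose t := \row_j k j.
  have : vecof b (t *m B) = 0.
    by rewrite vecofB -[RHS]k0; apply: eq_bigr => j _; rewrite mxE nthE.
  move=> /eqP; rewrite vecof_eq0 // => /eqP tB.
  have : t = 0 by rewrite -[t](mulmxK Bunit) tB mul0mx.
  by move=> /rowP/(_ i); rewrite !mxE.
apply/seteqP; split=> x /=.
  move=> Cx; have : K (rVof b x) by rewrite /K /= rVofK.
  rewrite KE => -[t t0 xt]; exists (fun j => t 0 j) => //.
  rewrite -[LHS](rVofK b_basis) xt vecofB.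
  by apply: eq_bigr => j _; rewrite nthE.
move=> [t t0 ->]; have : K (\row_j t j *m B).
  by rewrite KE; exists (\row_j t j) => // i; rewrite mxE.
rewrite /K /= vecofB; congr C; apply: eq_bigr => j _.
by rewrite nthE mxE.
Qed.

End Coordinates.

Lemma simplicial_basis : simplicial C ->
  exists b : d.-tuple V, [/\ basis_of {:V} b, forall i, C b`_i &
    coord_cone b = [set u | forall i, 0 <= u 0 i]].
Proof.
move=> [b [bb CE]]; exists b.
have inC u : C (vecof b u) <-> forall i, 0 <= u 0 i.
  rewrite CE; split=> [[t t0 ut] i|u0]; last by exists (fun i => u 0 i).
  by rewrite -(coord_vecof bb) ut (coord_sum_free _ _ (basis_free bb)).
split=> //; last by apply/seteqP; split=> u /inC.
move=> i; have [id|di] := ltnP i d; last first.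
  by rewrite nth_default ?size_tuple //; exact: cone0.
have := (inC (delta_mx 0 (Ordinal id))).2; rewrite vecof_delta; apply.
by move=> j; rewrite mxE; case: (_ && _).
Qed.

End ConeCoordinates.

Theorem theorem1p1 (R : realType) (V : vectType R) (hV : (0 < \dim {:V})%N)
    (C : set V) (hC : ccpg_cone C) :
  FS_domain (cone_domain hC) /\
  (RB_domain (cone_domain hC) <-> simplicial C).
Proof.
have [b [bb bC]] := cone_basis hC.
have hK := coord_cone_proper hC bb bC.
have hD := cone_domain_order hC bb.
split; first exact: cone_order_FS hK hD.
split=> [RB|/(simplicial_basis hC)[b' [bb' bC' KE]]].
  exact: (simplicial_coord bb (RB_simplicial hK hD hV RB)).
have hK' := coord_cone_proper hC bb' bC'.
have hD' := cone_domain_order hC bb'.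
apply: complete_domain_RB; first exact: cone_order_domain hK' hD'.
exact: orthant_complete hD' KE.
Qed.
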